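(* Let $\Theta_0,\Theta_1,\Theta_\infty\in\mathbb C$ with $\Theta_0,\Theta_1\notin\mathbb Z$, and let $\sigma,s^2,r\in\mathbb C\setminus\{0\}$ with $\Re\sigma\in[0,1)$. The function $\zeta(t)$ corresponding to the solution $(y,z,u)$ of the isomonodromy deformation system determined by the small-$t$ asymptotics with parameters $(\sigma,s^2,r)$ given in the context has the following asymptotic expansion as $t\to0$: \begin{align*} \zeta(t)&=\frac14\big(\sigma^2-\Theta_1^2+\Theta_0^2+2\Theta_0\Theta_\infty\big)-\frac{(\Theta_1+\sigma)^2-\Theta_0^2}{4s^2\sigma^2(1-\sigma)}\,t^{1-\sigma}+\frac t{4\sigma^2}\big(2\Theta_0\sigma^2+\Theta_\infty(\Theta_0^2-\Theta_1^2+\sigma^2)\big)\\ &\quad-\frac{s^2(\Theta_\infty^2-\sigma^2)\big((\Theta_1-\sigma)^2-\Theta_0^2\big)}{16\sigma^2(1+\sigma)}\,t^{1+\sigma}+\mathcal O\big(|t|^{2-2\Re\sigma}\big). \end{align*}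
   Context: **Notation.** $b(\sigma)=\frac{\Theta_1+\Theta_0+\sigma}2$, $c(\sigma)=\frac{\Theta_1-\Theta_0+\sigma}2$, $d(\sigma)=\frac{\Theta_\infty+\sigma}2$, $a(\sigma)=b(\sigma)c(\sigma)$. $\arg t$ is standard ($0$ for $t>0$) and bounded as $t\to0$. **Isomonodromy deformation system:** \begin{align*} t\frac{dy}{dt}&=ty-2z(y-1)^2-(y-1)\Big(\tfrac{\Theta_0-\Theta_1+\Theta_\infty}2y-\tfrac{3\Theta_0+\Theta_1+\Theta_\infty}2\Big),\\ t\frac{dz}{dt}&=yz\Big(z+\tfrac{\Theta_0-\Theta_1+\Theta_\infty}2\Big)-\frac1y(z+\Theta_0)\Big(z+\tfrac{\Theta_0+\Theta_1+\Theta_\infty}2\Big),\\ t\frac{d}{dt}\log u&=-2z-\Theta_0+y\Big(z+\tfrac{\Theta_0-\Theta_1+\Theta_\infty}2\Big)+\frac1y\Big(z+\tfrac{\Theta_0+\Theta_1+\Theta_\infty}2\Big). \end{align*} **$\zeta$-function:** $$\zeta(t)=\tfrac14\big((\Theta_0+\Theta_\infty)^2-\Theta_1^2\big)-zt-\Big(z-\tfrac1y\big(z+\tfrac{\Theta_0+\Theta_1+\Theta_\infty}2\big)\Big)\Big(z+\Theta_0-y\big(z+\tfrac{\Theta_0-\Theta_1+\Theta_\infty}2\big)\Big);$$ on solutions $\zeta'(t)=-z$. **The solution with parameters $(\sigma,s^2,r)$** is the unique solution with, as $t\to0$, \begin{align*} y&=\frac{(a(\sigma)+s^2d(-\sigma)a(-\sigma)t^\sigma)(b(\sigma)+s^2d(\sigma)b(-\sigma)t^\sigma)}{(a(\sigma)+s^2d(\sigma)a(-\sigma)t^\sigma)(b(\sigma)+s^2d(-\sigma)b(-\sigma)t^\sigma)}+\frac{1-\Theta_1-\Theta_0}{(1-\sigma)^2}t+\mathcal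 O(t^{1+\Re\sigma})+\mathcal O(t^{2-\Re\sigma}),\\ z&=\frac{(c(\sigma)+s^2d(\sigma)c(-\sigma)t^\sigma)(b(\sigma)+s^2d(-\sigma)b(-\sigma)t^\sigma)}{\sigma^2s^2t^\sigma}+2\Big(\frac{b(\sigma)c(\sigma)}{\sigma^2(1-\sigma)s^2t^\sigma}\Big)^2t+\mathcal O(t^{1-\Re\sigma})+\mathcal O(t^{2-3\Re\sigma}),\\ u&=-rt^{\Theta_\infty}\Big(\frac{b(\sigma)+s^2d(-\sigma)b(-\sigma)t^\sigma}{b(\sigma)+s^2d(\sigma)b(-\sigma)t^\sigma}\Big)(1+\mathcal O(t)). \end{align*} *)

(* Defs.v *)
From Stdlib Require Import Reals ZArith.
From Coquelicot Require Import Coquelicot.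
Open Scope C_scope.

(** ** The universal covering of [C \ {0}]

    Functions of [t] are multivalued, with [arg t] standard and bounded as
    [t -> 0].  A point of the universal covering is represented by its
    logarithm [tau], so that [t = Cexp tau], [|t| = exp (Re tau)],
    [arg t = Im tau], [t^s = Cexp (s * tau)] and [t d/dt = d/dtau]. *)

Definition Cexp (w : C) : C :=
  (exp (Re w) * cos (Im w), exp (Re w) * sin (Im w))%R.

Definition tpow (tau s : C) : C := Cexp (s * tau).

(** [|arg t| <= M] and [log |t| < K]. *)
Definition sector (M K : R) (tau : C) : Prop :=
  (Rabs (Im tau) <= M)%R /\ (Re tau < K)%R.

(** [f = O(g(|t|))] as [t -> 0] inside [E], [arg t] being bounded: the
    constants may depend on the bound [M] for the argument. *)
Definition bigO_0 (E : C -> Prop) (f : C -> C) (g : R -> R) : Prop :=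
  forall M : R, exists K A : R, forall tau : C,
    E tau -> sector M K tau -> (Cmod (f tau) <= A * g (exp (Re tau)))%R.

(** Since [locally'] is the punctured neighbourhood filter, this says that in
    each sector, close to [t = 0], the set [D] is open and its complement
    consists of isolated points (the zeros and poles of a solution, which may
    accumulate at [t = 0] when [Re sigma = 0]). *)
Definition cofinite_near_0 (D : C -> Prop) : Prop :=
  forall M : R, exists K : R, forall tau : C,
    sector M K tau -> locally' tau D.

(** [t] stays outside the discs [|log t - log p| < delta] around the zeros [p]
    of [f]. *)
Definition away (delta : R) (f : C -> C) (tau : C) : Prop :=
  forall p : C, f p = 0 -> (delta <= Cmod (tau - p))%R.

Definition not_integer (w : C) : Prop := forall n : Z, w <> RtoC (IZR n).

(** ** The isomonodromy deformation system *)

Section System.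

Variables Th0 Th1 Thoo : C.

Definition y_rhs (t y z : C) : C :=
  t * y - 2 * z * ((y - 1) * (y - 1))
  - (y - 1) * ((Th0 - Th1 + Thoo) / 2 * y - (3 * Th0 + Th1 + Thoo) / 2).

Definition z_rhs (t y z : C) : C :=
  y * z * (z + (Th0 - Th1 + Thoo) / 2)
  - / y * (z + Th0) * (z + (Th0 + Th1 + Thoo) / 2).

Definition logu_rhs (t y z : C) : C :=
  - 2 * z - Th0 + y * (z + (Th0 - Th1 + Thoo) / 2)
  + / y * (z + (Th0 + Th1 + Thoo) / 2).

(** [D] is the set of regular points of the solution; the equation for [log u]
    is written as [du/dtau = u * logu_rhs], which does not involve a branch of
    the logarithm. *)
Definition ids_solution (D : C -> Prop) (y z u : C -> C) : Prop :=
  cofinite_near_0 D /\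
  forall tau : C, D tau ->
    y tau <> 0 /\ u tau <> 0 /\
    is_derive y tau (y_rhs (Cexp tau) (y tau) (z tau)) /\
    is_derive z tau (z_rhs (Cexp tau) (y tau) (z tau)) /\
    is_derive u tau (u tau * logu_rhs (Cexp tau) (y tau) (z tau)).

Definition zeta (t y z : C) : C :=
  / 4 * ((Th0 + Thoo) * (Th0 + Thoo) - Th1 * Th1) - z * t
  - (z - / y * (z + (Th0 + Th1 + Thoo) / 2))
    * (z + Th0 - y * (z + (Th0 - Th1 + Thoo) / 2)).

(** ** Small-[t] asymptotics with parameters [(sigma, s^2, r)] *)

Definition b_ (sigma : C) : C := (Th1 + Th0 + sigma) / 2.
Definition c_ (sigma : C) : C := (Th1 - Th0 + sigma) / 2.
Definition d_ (sigma : C) : C := (Thoo + sigma) / 2.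
Definition a_ (sigma : C) : C := b_ sigma * c_ sigma.

(** [s2] stands for the parameter [s^2]. *)
Variables sigma s2 r : C.

Definition y_num (tau : C) : C :=
  (a_ sigma + s2 * d_ (- sigma) * a_ (- sigma) * tpow tau sigma)
  * (b_ sigma + s2 * d_ sigma * b_ (- sigma) * tpow tau sigma).

Definition y_den (tau : C) : C :=
  (a_ sigma + s2 * d_ sigma * a_ (- sigma) * tpow tau sigma)
  * (b_ sigma + s2 * d_ (- sigma) * b_ (- sigma) * tpow tau sigma).

Definition y_main (tau : C) : C :=
  y_num tau / y_den tau
  + (1 - Th1 - Th0) / ((1 - sigma) * (1 - sigma)) * Cexp tau.

Definition z_second (tau : C) : C :=
  b_ sigma * c_ sigma / (sigma * sigma * (1 - sigma) * s2 * tpow tau sigma).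

Definition z_main (tau : C) : C :=
  (c_ sigma + s2 * d_ sigma * c_ (- sigma) * tpow tau sigma)
  * (b_ sigma + s2 * d_ (- sigma) * b_ (- sigma) * tpow tau sigma)
  / (sigma * sigma * s2 * tpow tau sigma)
  + 2 * (z_second tau * z_second tau) * Cexp tau.

Definition u_num (tau : C) : C :=
  b_ sigma + s2 * d_ (- sigma) * b_ (- sigma) * tpow tau sigma.

Definition u_den (tau : C) : C :=
  b_ sigma + s2 * d_ sigma * b_ (- sigma) * tpow tau sigma.

Definition u_main (tau : C) : C :=
  - r * tpow tau Thoo * (u_num tau / u_den tau).

(** The leading term of [z] has no poles, so its expansion holds at all regular
    points.  For [Re sigma = 0] the leading terms of [y] and [u] can have poles
    accumulating at [t = 0], and that of [u], whose error is multiplicative,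
    can have such zeros; those expansions hold uniformly outside the discs
    [|log t - log p| < delta], for each [delta > 0].  When
    [0 < Re sigma < 1], only finitely many of the points [p] lie in a given
    sector, so nothing is removed near [t = 0].  The first clause says that
    the leading terms make sense: if [y_den] is not identically zero then
    neither are [u_num] and (as [sigma <> 0]) [u_den]. *)
Definition small_t_asymptotics (D : C -> Prop) (y z u : C -> C) : Prop :=
  (exists tau : C, y_den tau <> 0) /\
  (forall delta : R, (0 < delta)%R ->
     bigO_0 (fun tau => D tau /\ away delta y_den tau)
       (fun tau => y tau - y_main tau)
       (fun x => Rpower x (1 + Re sigma) + Rpower x (2 - Re sigma))%R) /\
  bigO_0 D
    (fun tau => z tau - z_main tau)
    (fun x => Rpower x (1 - Re sigma) + Rpower x (2 - 3 * Re sigma))%R /\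
  (forall delta : R, (0 < delta)%R ->
     bigO_0 (fun tau => D tau /\ away delta u_num tau /\ away delta u_den tau)
       (fun tau => u tau / u_main tau - 1)
       (fun x => x)).

Definition zeta_main (tau : C) : C :=
  / 4 * (sigma * sigma - Th1 * Th1 + Th0 * Th0 + 2 * Th0 * Thoo)
  - ((Th1 + sigma) * (Th1 + sigma) - Th0 * Th0)
    / (4 * s2 * (sigma * sigma) * (1 - sigma)) * tpow tau (1 - sigma)
  + Cexp tau / (4 * (sigma * sigma))
    * (2 * Th0 * (sigma * sigma)
       + Thoo * (Th0 * Th0 - Th1 * Th1 + sigma * sigma))
  - s2 * (Thoo * Thoo - sigma * sigma)
    * ((Th1 - sigma) * (Th1 - sigma) - Th0 * Th0)
    / (16 * (sigma * sigma) * (1 + sigma)) * tpow tau (1 + sigma).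

End System.

(* Main.v *)
(** In the variable [tau = log t] a solution satisfies [d zeta / d tau = - z t].
    Inserting the expansion of [z] and integrating from [t = 0] gives the
    expansion of [zeta] up to its constant term.  Since the complement of [D] is
    only locally finite, this integration is a mean value estimate along
    segments that are shifted off the exceptional points; it shows that
    [f = zeta - zeta_main] has a limit at [t = 0], approached at the rate
    [|t|^(2 - 2 Re sigma)].

    To see that the limit is zero, let [X = z (1 - y)]; then
    [zeta = zeta_cst - z t + (X + e2) (X + Th0 - e1 y) / y], and in [1 - y] the
    factor [t^sigma] compensates the growth of [z], so that the leading terms of
    [y] and [z] determine the limit.  When [Re sigma = 0] this is read off on a
    horizontal line in the [tau]-plane on which the leading terms have neither
    zeros nor poles.  When [c_ sigma = 0] the function [1 - y] does not tend to
    zero, and the given error of [z] is too large if [Re sigma >= 2/3].  Then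
    [S = 2 X + e2 + Th0 - e1 y] is used instead: it is bounded because
    [S^2 = 4 y (zeta - zeta_cst + z t) + (e2 - Th0 + e1 y)^2], while
    [dS / d tau] tends to a nonzero multiple of the limit of [f], which
    therefore vanishes. *)
Require Import Defs.
From Stdlib Require Import Reals ZArith Lra Psatz Classical ClassicalEpsilon.
From Coquelicot Require Import Coquelicot.
Open Scope C_scope.

(** * Differentiation of complex functions along real lines *)

(** Derivatives are taken componentwise, so that the real mean value theorem and [auto_derive]
    apply. *)
Definition is_dC (f : R -> C) (s : R) (l : C) : Prop :=
  is_derive (fun x => Re (f x)) s (Re l) /\
  is_derive (fun x => Im (f x)) s (Im l).

Lemma is_dC_ext (f g : R -> C) (s : R) (l m : C) :
  (forall x, f x = g x) -> l = m -> is_dC f s l -> is_dC g s m.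
Proof.
  intros Hfg <- [H1 H2]; split;
    [apply (is_derive_ext (fun x => Re (f x))) | apply (is_derive_ext (fun x => Im (f x)))];
    try assumption; intros t; now rewrite Hfg.
Qed.

Lemma is_dC_const (c : C) (s : R) : is_dC (fun _ => c) s 0.
Proof. split; simpl; apply @is_derive_const. Qed.

Lemma is_dC_plus (f g : R -> C) (s : R) (l m : C) :
  is_dC f s l -> is_dC g s m -> is_dC (fun x => f x + g x) s (l + m).
Proof. intros [H1 H2] [H3 H4]; split; simpl; now apply @is_derive_plus. Qed.

Lemma is_dC_opp (f : R -> C) (s : R) (l : C) :
  is_dC f s l -> is_dC (fun x => - f x) s (- l).
Proof. intros [H1 H2]; split; simpl; now apply @is_derive_opp. Qed.

Lemma is_dC_minus (f g : R -> C) (s : R) (l m : C) :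
  is_dC f s l -> is_dC g s m -> is_dC (fun x => f x - g x) s (l - m).
Proof. intros Hf Hg; apply is_dC_plus; [|apply is_dC_opp]; assumption. Qed.

Lemma is_dC_mult (f g : R -> C) (s : R) (l m : C) :
  is_dC f s l -> is_dC g s m ->
  is_dC (fun x => f x * g x) s (l * g s + f s * m).
Proof.
  intros [H1 H2] [H3 H4].
  (* Explicit pairs of real functions let [auto_derive] compute; surjectivity of pairing brings [f]
     and [g] back. *)
  assert (Gen : forall a b c d : R -> R, forall a' b' c' d' : R,
    is_derive a s a' -> is_derive b s b' -> is_derive c s c' -> is_derive d s d' ->
    is_dC (fun x => (a x, b x) * (c x, d x)) s
      ((a', b') * (c s, d s) + (a s, b s) * (c', d'))).
  { clear. intros a b c d a' b' c' d' H1 H2 H3 H4.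
    split; simpl; (auto_derive; [repeat split; eexists; eassumption |]);
    rewrite (is_derive_unique (fun x : R => a x) _ _ H1), (is_derive_unique (fun x : R => b x) _ _ H2),
      (is_derive_unique (fun x : R => c x) _ _ H3), (is_derive_unique (fun x : R => d x) _ _ H4); ring. }
  assert (G := Gen _ _ _ _ _ _ _ _ H1 H2 H3 H4).
  eapply is_dC_ext; [| |exact G]; intros; cbv beta; now rewrite <- !surjective_pairing.
Qed.

Lemma Cnorm2_neq_0 (w : C) : w <> 0 -> (fst w * fst w + snd w * snd w <> 0)%R.
Proof.
  intros Hw H; apply Hw; destruct w as [a b]; simpl in *.
  assert (a = 0)%R by nra; assert (b = 0)%R by nra; subst; reflexivity.
Qed.

Lemma is_dC_inv (f : R -> C) (s : R) (l : C) :
  f s <> 0 -> is_dC f s l -> is_dC (fun x => / f x) s (- (l * (/ f s * / f s))).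
Proof.
  intros H0 [H1 H2]. apply Cnorm2_neq_0 in H0.
  assert (Gen : forall a b : R -> R, forall a' b' : R,
    is_derive a s a' -> is_derive b s b' -> (a s * a s + b s * b s <> 0)%R ->
    is_dC (fun x => / (a x, b x)) s (- ((a', b') * (/ (a s, b s) * / (a s, b s))))).
  { clear. intros a b a' b' H1 H2 H0.
    split; simpl; (auto_derive;
      [repeat split; try (eexists; eassumption); intros H; apply H0; rewrite <- H; ring |]);
    rewrite (is_derive_unique (fun x : R => a x) _ _ H1), (is_derive_unique (fun x : R => b x) _ _ H2);
    field; intros H; apply H0; rewrite <- H; ring. }
  assert (G := Gen _ _ _ _ H1 H2 H0).
  eapply is_dC_ext; [| |exact G]; intros; cbv beta; now rewrite <- !surjective_pairing.
Qed.

Lemma is_dC_Cexp (f : R -> C) (s : R) (l : C) :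
  is_dC f s l -> is_dC (fun x => Cexp (f x)) s (l * Cexp (f s)).
Proof.
  intros [H1 H2].
  assert (Gen : forall a b : R -> R, forall a' b' : R,
    is_derive a s a' -> is_derive b s b' ->
    is_dC (fun x => Cexp (a x, b x)) s ((a', b') * Cexp (a s, b s))).
  { clear. intros a b a' b' H1 H2.
    split; simpl; (auto_derive; [repeat split; eexists; eassumption |]);
    rewrite (is_derive_unique (fun x : R => a x) _ _ H1), (is_derive_unique (fun x : R => b x) _ _ H2); ring. }
  assert (G := Gen _ _ _ _ H1 H2).
  eapply is_dC_ext; [| |exact G]; intros; cbv beta; now rewrite <- !surjective_pairing.
Qed.

Lemma is_dC_line (p v : C) (s : R) : is_dC (fun x => p + x * v) s v.
Proof.
  split; destruct p as [p1 p2], v as [v1 v2]; simpl;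
  (auto_derive; [exact I | ring]).
Qed.

Lemma is_dC_continuous (f : R -> C) (s : R) (l : C) :
  is_dC f s l -> continuous (fun x => Cmod (f x)) s.
Proof.
  intros [H1 H2].
  assert (C1 : continuous (fun x => Re (f x)) s)
    by (apply @ex_derive_continuous; eexists; eassumption).
  assert (C2 : continuous (fun x => Im (f x)) s)
    by (apply @ex_derive_continuous; eexists; eassumption).
  unfold Cmod, Re, Im in *.
  apply (continuous_comp (fun x => (fst (f x) ^ 2 + snd (f x) ^ 2)%R) sqrt).
  - apply @continuous_plus; simpl;
      apply @continuous_mult; auto; apply @continuous_mult; auto;
      apply continuous_const.
  - apply continuous_sqrt.
Qed.

Lemma is_derive_C_small_o (f : C -> C) (p l : C) :
  is_derive f p l ->
  forall e : posreal, exists d : posreal, forall w : C,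
    (Cmod (w - p) < d)%R ->
    (Cmod (f w - f p - (w - p) * l)%C <= e * Cmod (w - p))%R.
Proof.
  intros [_ H] e.
  destruct (H p (fun P HP => HP) e) as [d Hd].
  exists d. intros w Hw. exact (Hd w Hw).
Qed.

Lemma is_derive_is_dC (f : C -> C) (p v l : C) (s : R) :
  is_derive f (p + s * v) l -> is_dC (fun x => f (p + x * v)) s (v * l).
Proof.
  intros Hf.
  assert (Key : forall e : posreal, exists d : posreal, forall h : R, h <> 0%R ->
    (Rabs h < d)%R ->
    (Cmod (f (p + (s + h)%R * v) - f (p + s * v) - h * (v * l))%C < e * Rabs h)%R).
  { intros e.
    (* Dividing by [Cmod v + 1] covers [v = 0] and yields the strict inequality. *)
    assert (Hv : (0 < Cmod v + 1)%R) by (pose proof (Cmod_ge_0 v); lra).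
    assert (He : (0 < e / (Cmod v + 1))%R) by (apply Rdiv_lt_0_compat; [apply e | lra]).
    destruct (is_derive_C_small_o _ _ _ Hf (mkposreal _ He)) as [d Hd].
    assert (Hd' : (0 < d / (Cmod v + 1))%R) by (apply Rdiv_lt_0_compat; [apply d | lra]).
    exists (mkposreal _ Hd'); intros h Hh Hlt; simpl in Hlt.
    assert (Hdiff : p + (s + h)%R * v - (p + s * v) = h * v)
      by (rewrite RtoC_plus; ring).
    assert (Hm : (Cmod (h * v) = Rabs h * Cmod v)%R)
      by (rewrite Cmod_mult, Cmod_R; reflexivity).
    pose proof (Rabs_pos_lt h Hh).
    specialize (Hd (p + (s + h)%R * v)). rewrite Hdiff, Hm in Hd. simpl in Hd.
    apply Rlt_div_r in Hlt; [|lra].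
    replace (h * (v * l)) with (h * v * l) by ring.
    eapply Rle_lt_trans; [apply Hd; nra |].
    pose proof (cond_pos e).
    replace (e / (Cmod v + 1) * (Rabs h * Cmod v))%R
      with (e * Rabs h * (Cmod v / (Cmod v + 1)))%R by (field; lra).
    assert (Cmod v / (Cmod v + 1) < 1)%R by (apply Rlt_div_l; lra).
    assert (0 < e * Rabs h)%R by nra. nra. }
  assert (Gen : forall (g : C -> R), (forall a b, g (a - b)%C = g a - g b)%R ->
    (forall a, Rabs (g a) <= Cmod a)%R -> (forall (h : R) a, g (h * a)%C = h * g a)%R ->
    is_derive (fun x : R => g (f (p + x * v))) s (g (v * l))).
  { intros g G1 G2 G3. apply is_derive_Reals. intros e He.
    destruct (Key (mkposreal e He)) as [d Hd]. exists d. intros h Hh Hlt.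
    specialize (Hd h Hh Hlt). simpl in Hd. pose proof (Rabs_pos_lt h Hh).
    replace ((g (f (p + (s + h)%R * v)%C) - g (f (p + s * v)%C)) / h - g (v * l)%C)%R
      with (g (f (p + (s + h)%R * v) - f (p + s * v) - h * (v * l))%C / h)%R
      by (rewrite !G1, G3; field; assumption).
    unfold Rdiv. rewrite Rabs_mult, Rabs_inv.
    apply Rlt_div_l; [assumption|].
    eapply Rle_lt_trans; [apply G2 | exact Hd]. }
  split.
  - apply (Gen Re).
    + intros; reflexivity.
    + intros a. eapply Rle_trans; [apply Rmax_l | apply Rmax_Cmod].
    + intros h a; destruct a; simpl; ring.
  - apply (Gen Im).
    + intros; reflexivity.
    + intros a. eapply Rle_trans; [apply Rmax_r | apply Rmax_Cmod].
    + intros h a; destruct a; simpl; ring.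
Qed.

Lemma mean_value_le (h h' : R -> R) (b : R) :
  (forall s, (0 <= s <= 1)%R -> is_derive h s (h' s)) ->
  (forall s, (0 <= s <= 1)%R -> (h' s <= b)%R) -> (h 1 - h 0 <= b)%R.
Proof.
  intros Hh Hb.
  destruct (MVT_gen h 0 1 h') as [c [Hc Heq]].
  - intros x Hx; rewrite Rmin_left, Rmax_right in Hx by lra; apply Hh; lra.
  - intros x Hx; rewrite Rmin_left, Rmax_right in Hx by lra.
    apply continuity_pt_filterlim, (ex_derive_continuous h).
    eexists; apply Hh; lra.
  - rewrite Rmin_left, Rmax_right in Hc by lra.
    specialize (Hb c Hc). lra.
Qed.

(** The increment [w] of [f] is projected on its own direction. By Cauchy-Schwarz the real function
    [h] below has nonpositive derivative, and [h 1 <= h 0] says that [|w|^2 <= |w| (g 1 - g 0)]. *)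
Lemma is_dC_mean_value (f f' : R -> C) (g g' : R -> R) :
  (forall s, (0 <= s <= 1)%R -> is_dC f s (f' s)) ->
  (forall s, (0 <= s <= 1)%R -> is_derive g s (g' s)) ->
  (forall s, (0 <= s <= 1)%R -> (Cmod (f' s) <= g' s)%R) ->
  (Cmod (f 1%R - f 0%R) <= g 1 - g 0)%R.
Proof.
  intros Hf Hg Hb.
  set (w := f 1%R - f 0%R).
  (* This settles the case [w = 0], where [|w|] cannot be cancelled. *)
  assert (Hg0 : (- g 1 - - g 0 <= 0)%R).
  { apply (mean_value_le (fun s => (- g s)%R) (fun s => (- g' s)%R)).
    - intros s Hs. apply @is_derive_opp. auto.
    - intros s Hs. pose proof (Cmod_ge_0 (f' s)). specialize (Hb s Hs). lra. }
  set (h := fun s => (Re w * Re (f s) + Im w * Im (f s) - Cmod w * g s)%R).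
  assert (Hh : (h 1 - h 0 <= 0)%R).
  { apply (mean_value_le h
      (fun s => (Re w * Re (f' s) + Im w * Im (f' s) - Cmod w * g' s)%R)).
    - intros s Hs. destruct (Hf s Hs) as [H1 H2].
      apply @is_derive_minus; [apply @is_derive_plus|]; apply is_derive_scal; auto.
    - intros s Hs. specialize (Hb s Hs).
      assert (CS : (Re w * Re (f' s) + Im w * Im (f' s) <= Cmod w * Cmod (f' s))%R).
      { replace (Re w * Re (f' s) + Im w * Im (f' s))%R with (Re (Cconj w * f' s))
          by (destruct w, (f' s); simpl; ring).
        eapply Rle_trans; [apply Rle_abs|].
        eapply Rle_trans; [eapply Rle_trans; [apply Rmax_l | apply Rmax_Cmod]|].
        rewrite Cmod_mult, Cmod_conj. lra. }
      pose proof (Cmod_ge_0 w). nra. }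
  assert (Hw : (Cmod w * Cmod w = Re w * Re w + Im w * Im w)%R).
  { unfold Cmod. rewrite sqrt_sqrt; [simpl; unfold Re, Im; ring | nra]. }
  assert (Hh' : (h 1 - h 0 = Cmod w * Cmod w - Cmod w * (g 1 - g 0))%R).
  { rewrite Hw. unfold h, w. destruct (f 1%R), (f 0%R); simpl; ring. }
  rewrite Hh' in Hh. pose proof (Cmod_ge_0 w). nra.
Qed.

(** * A mean value estimate off an isolated set *)

Lemma le_0_continuous (g : R -> R) (d : R) :
  (0 < d)%R -> continuous g 0%R ->
  (forall h, (0 < h < d)%R -> (0 <= g h)%R) -> (0 <= g 0)%R.
Proof.
  intros Hd Hc Hg. apply Rnot_lt_le; intros Hneg.
  assert (Hl : locally (g 0%R) (fun x => (x < 0)%R)).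
  { exists (mkposreal (- g 0%R) ltac:(lra)). intros x Hx.
    apply Rabs_def2 in Hx. unfold minus, plus, opp in Hx; simpl in Hx. lra. }
  destruct (Hc _ Hl) as [e He].
  pose proof (cond_pos e) as He0.
  set (h := (Rmin e d / 2)%R).
  assert (0 < Rmin e d)%R by (apply Rmin_pos; assumption).
  pose proof (Rmin_l e d); pose proof (Rmin_r e d).
  assert (g h < 0)%R.
  { apply He. apply Rabs_def1; unfold minus, plus, opp, h; simpl; lra. }
  specialize (Hg h). unfold h in *. lra.
Qed.

(** The neighbourhoods in [locally'] are product balls, so a small modulus has to be turned into two
    small components. *)
Lemma locally'_C (p : C) (D : C -> Prop) :
  locally' p D -> exists d : posreal, forall w : C,
    (Cmod (w - p) < d)%R -> w <> p -> D w.
Proof.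
  intros [d Hd]. exists d. intros w Hw Hne. apply Hd; [|exact Hne].
  pose proof (Rmax_Cmod (w - p)) as HR.
  pose proof (Rmax_l (Rabs (fst (w - p))) (Rabs (snd (w - p)))).
  pose proof (Rmax_r (Rabs (fst (w - p))) (Rabs (snd (w - p)))).
  split; (eapply Rle_lt_trans; [|exact Hw]); (eapply Rle_trans; [|exact HR]); assumption.
Qed.

(** Compactness of [[0,1]] gives the punctured discs along the segment a common width. A point
    shifted sideways by [h > 0] is off the segment, hence never the centre of such a disc. *)
Lemma strip_beside_segment (D : C -> Prop) (p v : C) :
  v <> 0 -> (forall s : R, (0 <= s <= 1)%R -> locally' (p + s * v) D) ->
  exists d : R, (0 < d)%R /\ forall h s : R, (0 < h < d)%R -> (0 <= s <= 1)%R ->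
    D (p + h * (Ci * v) + s * v).
Proof.
  intros Hv HD.
  assert (Hv' := proj1 (Cmod_gt_0 v) Hv).
  (* The factor 2 leaves room for the distance along the segment, [|s - t| < delta t], and the
     sideways shift, [h < d <= delta t]. Parameters outside [[0,1]] get a dummy radius. *)
  assert (Hex : forall s : R, exists e : posreal, (0 <= s <= 1)%R ->
    forall w : C, (Cmod (w - (p + s * v)) < 2 * e * Cmod v)%R -> w <> p + s * v -> D w).
  { intros s. destruct (classic (0 <= s <= 1)%R) as [Hs|Hs].
    - destruct (locally'_C _ _ (HD s Hs)) as [e He].
      assert (He' : (0 < e / (2 * Cmod v))%R)
        by (apply Rdiv_lt_0_compat; [apply e | lra]).
      exists (mkposreal _ He'). intros _ w Hw. apply He. simpl in Hw.
      replace (pos e) with (2 * (e / (2 * Cmod v)) * Cmod v)%R by (field; lra).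
      exact Hw.
    - exists (mkposreal 1 Rlt_0_1). tauto. }
  set (delta := fun s => proj1_sig (constructive_indefinite_description _ (Hex s))).
  destruct (compactness_value_1d 0 1 delta) as [d Hd].
  exists d. split; [apply d|]. intros h s Hh Hs.
  destruct (NNPP _ (Hd s Hs)) as [t [Ht [Hst Hdt]]].
  assert (HDt : forall w : C,
    (Cmod (w - (p + t * v)) < 2 * delta t * Cmod v)%R -> w <> p + t * v -> D w)
    by exact (proj2_sig (constructive_indefinite_description _ (Hex t)) Ht).
  clearbody delta.
  assert (Hdiff : p + h * (Ci * v) + s * v - (p + t * v) = ((s - t)%R + h * Ci) * v)
    by (rewrite RtoC_minus; ring).
  apply HDt.
  - rewrite Hdiff, Cmod_mult. apply Rmult_lt_compat_r; [assumption|].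
    eapply Rle_lt_trans; [apply Cmod_triangle|].
    rewrite Cmod_mult, !Cmod_R, Cmod_Ci, (Rabs_pos_eq h) by lra.
    lra.
  - intros E. assert (E' : ((s - t)%R + h * Ci) * v = 0) by (rewrite <- Hdiff, E; ring).
    revert E'. apply Cmult_neq_0; [|assumption]. intros E'.
    apply (f_equal snd) in E'. simpl in E'. lra.
Qed.

(** Complex differentiability is only used along real lines, where the mean value
    theorem applies. *)
Definition derivable_on (D : C -> Prop) (f f' : C -> C) : Prop :=
  forall (p v : C) (s : R), D (p + s * v) ->
    is_dC (fun x => f (p + x * v)) s (v * f' (p + s * v)).

(* The segment from [p] to [q] may hit points outside [D]; it is shifted
   sideways by a small [h], and then [h] tends to [0]. *)
Lemma derivable_on_mean_value (D : C -> Prop) (f f' : C -> C) (phi phi' : R -> R)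
    (M K : R) (p q : C) :
  derivable_on D f f' ->
  (forall w, sector (M + 1) K w -> locally' w D) ->
  (forall w, D w -> sector (M + 1) K w -> (Cmod (f' w) <= phi' (Re w))%R) ->
  (forall x, is_derive phi x (phi' x)) ->
  D p -> D q -> sector M K p -> sector M K q -> (Re q < Re p)%R ->
  (Cmod (f q - f p)%C * (Re p - Re q) <= Cmod (q - p)%C * (phi (Re p) - phi (Re q)))%R.
Proof.
  intros Hf HD Hb Hphi Dp Dq [Mp Kp] [Mq Kq] Hpq.
  (* [eta] is the real part of [Ci * v]: the change of [Re] per unit of sideways shift. *)
  set (v := q - p). set (X := (Re p - Re q)%R). set (eta := (- Im v)%R).
  assert (HX : (0 < X)%R) by (unfold X; lra).
  assert (Hv : v <> 0).
  { intros E. apply (f_equal fst) in E. unfold v, Re in *; simpl in E. lra. }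
  assert (Hq : q = p + v) by (unfold v; ring).
  assert (Hv' := proj1 (Cmod_gt_0 v) Hv).
  assert (Rev : Re v = (- X)%R) by (unfold v, X, Re; simpl; ring).
  assert (Imv : (Im q = Im p + Im v)%R) by (unfold v, Im; simpl; ring).
  assert (Hconv : forall s, (0 <= s <= 1)%R -> (Rabs (Im p + s * Im v) <= M)%R).
  { intros s Hs. apply Rabs_le. apply Rabs_le_between in Mp, Mq. nra. }
  assert (Hseg : forall s : R, (0 <= s <= 1)%R -> locally' (p + s * v) D).
  { intros s Hs. apply HD. split.
    - replace (Im (p + s * v)) with (Im p + s * Im v)%R by (unfold Im; simpl; ring).
      specialize (Hconv s Hs). lra.
    - replace (Re (p + s * v)) with (Re p + s * Re v)%R by (unfold Re; simpl; ring).
      rewrite Rev. nra. }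
  destruct (strip_beside_segment D p v Hv Hseg) as [d [Hd0 Hd]].
  (* For [h < d'] the shift is shorter than 1 and than [K - Re p], which keeps the shifted segment
     inside [sector (M + 1) K]. *)
  set (d' := Rmin d (Rmin (1 / Cmod v) ((K - Re p) / Cmod v))).
  assert (Hd' : (0 < d')%R)
    by (unfold d'; repeat apply Rmin_pos; try assumption; apply Rdiv_lt_0_compat; lra).
  assert (Hsmall : forall h, (0 < h < d')%R ->
    (h < d /\ h * Cmod v < 1 /\ h * Cmod v < K - Re p)%R).
  { intros h Hh. unfold d' in Hh.
    pose proof (Rmin_l d (Rmin (1 / Cmod v) ((K - Re p) / Cmod v))).
    pose proof (Rmin_r d (Rmin (1 / Cmod v) ((K - Re p) / Cmod v))).
    pose proof (Rmin_l (1 / Cmod v) ((K - Re p) / Cmod v)).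
    pose proof (Rmin_r (1 / Cmod v) ((K - Re p) / Cmod v)).
    repeat split; [lra| |]; apply Rlt_div_r; lra. }
  assert (Rle_v : (Rabs (Re v) <= Cmod v)%R)
    by (eapply Rle_trans; [apply Rmax_l | apply Rmax_Cmod]).
  assert (Ile_v : (Rabs (Im v) <= Cmod v)%R)
    by (eapply Rle_trans; [apply Rmax_r | apply Rmax_Cmod]).
  apply Rabs_le_between in Rle_v, Ile_v.
  (* [0 <= G h] is the estimate for the shifted end points; continuity at [0] carries it to [p] and
     [q]. *)
  set (F := fun x : R => f (q + x * (Ci * v)) - f (p + x * (Ci * v))).
  set (G := fun h : R =>
    (Cmod v / X * (phi (Re p + h * eta) - phi (Re q + h * eta)) - Cmod (F h))%R).
  assert (HG : (0 <= G 0)%R).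
  { apply (le_0_continuous G d' Hd').
    - apply @continuous_minus.
      + apply @continuous_scal; [apply continuous_const|].
        apply @continuous_minus; apply (continuous_comp (fun h : R => _ + h * eta)%R phi);
        try (apply (ex_derive_continuous phi); eexists; apply Hphi);
        (apply @continuous_plus; [apply continuous_const|]);
        apply @continuous_mult; [apply continuous_id | apply continuous_const
          | apply continuous_id | apply continuous_const].
      + eapply is_dC_continuous. apply is_dC_minus; apply Hf;
        (match goal with |- D (?a + _) => replace (a + 0%R * (Ci * v)) with a by ring end);
        assumption.
    - intros h Hh. destruct (Hsmall h Hh) as [h1 [h2 h3]].
      unfold G. apply Rge_le, Rge_minus, Rle_ge.
      set (p' := p + h * (Ci * v)).
      assert (HF : F h = f (p' + 1%R * v) - f (p' + 0%R * v)).
      { unfold F, p'. rewrite Hq. f_equal; f_equal; ring. }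
      rewrite HF.
      eapply Rle_trans.
      (* The point moves with speed [Cmod v] while its real part decreases at rate [X], whence the
         factor [Cmod v / X]. *)
      + apply (is_dC_mean_value (fun x => f (p' + x * v)) (fun x => v * f' (p' + x * v))
          (fun s => - (Cmod v / X) * phi (Re p + h * eta - s * X))%R
          (fun s => Cmod v * phi' (Re p + h * eta - s * X))%R).
        * intros s Hs. apply Hf. unfold p'. apply Hd; lra.
        * intros s Hs.
          auto_derive; [eexists; apply Hphi|].
          rewrite (is_derive_unique (fun x : R => phi x) _ _ (Hphi _)). unfold Rminus. field. lra.
        * intros s Hs. rewrite Cmod_mult. apply Rmult_le_compat_l; [lra|].
          assert (HRe : Re (p' + s * v) = (Re p + h * eta - s * X)%R).
          { replace X with (- Re v)%R by lra.
            unfold p', eta, Re, Im; simpl. ring. }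
          rewrite <- HRe. apply Hb; [apply Hd; lra|].
          split.
          -- replace (Im (p' + s * v)) with (Im p + s * Im v + h * Re v)%R
               by (unfold p', Re, Im; simpl; ring).
             specialize (Hconv s Hs). apply Rabs_le_between in Hconv. apply Rabs_le.
             assert (- (h * Cmod v) <= h * Re v <= h * Cmod v)%R by nra. lra.
          -- rewrite HRe. assert (h * eta <= h * Cmod v)%R by (unfold eta; nra). nra.
      + replace (Re p + h * eta - 0 * X)%R with (Re p + h * eta)%R by ring.
        replace (Re p + h * eta - 1 * X)%R with (Re q + h * eta)%R by (unfold X; ring).
        right. ring. }
  unfold G, F in HG.
  replace (q + 0%R * (Ci * v)) with q in HG by ring.
  replace (p + 0%R * (Ci * v)) with p in HG by ring.
  rewrite !Rmult_0_l, !Rplus_0_r in HG.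
  apply Rle_div_r; [assumption|].
  unfold Rdiv in *. fold v. nra.
Qed.

(** * Differentiation rules on a set of regular points *)

Lemma derivable_on_ext (D : C -> Prop) (f g f' g' : C -> C) :
  (forall w, f w = g w) -> (forall w, D w -> f' w = g' w) ->
  derivable_on D f f' -> derivable_on D g g'.
Proof.
  intros Hf Hf' H p v s Hs. eapply is_dC_ext; [| |apply H, Hs].
  - intros; apply Hf.
  - simpl. now rewrite Hf'.
Qed.

Lemma derivable_on_is_derive (D : C -> Prop) (f f' : C -> C) :
  (forall w, D w -> is_derive f w (f' w)) -> derivable_on D f f'.
Proof. intros H p v s Hs. now apply is_derive_is_dC, H. Qed.

Lemma derivable_on_const (D : C -> Prop) (c : C) :
  derivable_on D (fun _ => c) (fun _ => 0).
Proof.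
  intros p v s _. eapply is_dC_ext; [| |apply (is_dC_const c)]; intros; [reflexivity | ring].
Qed.

Lemma derivable_on_id (D : C -> Prop) : derivable_on D (fun w => w) (fun _ => 1).
Proof.
  intros p v s _. eapply is_dC_ext; [| |apply is_dC_line]; intros; [reflexivity | ring].
Qed.

Lemma derivable_on_plus (D : C -> Prop) (f g f' g' : C -> C) :
  derivable_on D f f' -> derivable_on D g g' ->
  derivable_on D (fun w => f w + g w) (fun w => f' w + g' w).
Proof.
  intros Hf Hg p v s Hs.
  eapply is_dC_ext; [| |apply is_dC_plus; [apply Hf, Hs | apply Hg, Hs]];
    intros; simpl; [reflexivity | ring].
Qed.

Lemma derivable_on_minus (D : C -> Prop) (f g f' g' : C -> C) :
  derivable_on D f f' -> derivable_on D g g' ->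
  derivable_on D (fun w => f w - g w) (fun w => f' w - g' w).
Proof.
  intros Hf Hg p v s Hs.
  eapply is_dC_ext; [| |apply is_dC_minus; [apply Hf, Hs | apply Hg, Hs]];
    intros; simpl; [reflexivity | ring].
Qed.

Lemma derivable_on_mult (D : C -> Prop) (f g f' g' : C -> C) :
  derivable_on D f f' -> derivable_on D g g' ->
  derivable_on D (fun w => f w * g w) (fun w => f' w * g w + f w * g' w).
Proof.
  intros Hf Hg p v s Hs.
  eapply is_dC_ext; [| |apply is_dC_mult; [apply Hf, Hs | apply Hg, Hs]];
    intros; simpl; [reflexivity | ring].
Qed.

Lemma derivable_on_inv (D : C -> Prop) (f f' : C -> C) :
  (forall w, D w -> f w <> 0) -> derivable_on D f f' ->
  derivable_on D (fun w => / f w) (fun w => - (f' w * (/ f w * / f w))).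
Proof.
  intros H0 Hf p v s Hs.
  eapply is_dC_ext; [| |apply (is_dC_inv (fun x => f (p + x * v))); [apply H0, Hs | apply Hf, Hs]];
    intros; simpl; [reflexivity | ring].
Qed.

Lemma derivable_on_tpow (D : C -> Prop) (k : C) :
  derivable_on D (fun w => tpow w k) (fun w => k * tpow w k).
Proof.
  intros p v s Hs. unfold tpow.
  eapply is_dC_ext; [| |apply is_dC_Cexp, is_dC_mult;
    [apply is_dC_const | apply is_dC_line]]; intros; cbv beta; [reflexivity | ring].
Qed.

Lemma derivable_on_Cexp (D : C -> Prop) : derivable_on D Cexp Cexp.
Proof.
  eapply derivable_on_ext; [| |apply (derivable_on_tpow D 1)];
    intros; unfold tpow; rewrite !Cmult_1_l; reflexivity.
Qed.

(** * The complex exponential and the powers of [t] *)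

Lemma Cexp_plus (v w : C) : Cexp (v + w) = Cexp v * Cexp w.
Proof.
  unfold Cexp, Re, Im, Cplus, Cmult; simpl.
  rewrite exp_plus, cos_plus, sin_plus. f_equal; ring.
Qed.

Lemma Cexp_0 : Cexp 0 = 1.
Proof. unfold Cexp; simpl. rewrite exp_0, cos_0, sin_0. unfold RtoC. f_equal; ring. Qed.

Lemma Cexp_neq_0 (w : C) : Cexp w <> 0.
Proof.
  intros H. assert (H1 : Cexp (w + - w) = 0) by (rewrite Cexp_plus, H; ring).
  rewrite Cplus_opp_r, Cexp_0 in H1. apply (f_equal fst) in H1. simpl in H1. lra.
Qed.

Lemma Cinv_neq_0 (w : C) : w <> 0 -> / w <> 0.
Proof.
  intros Hw H. apply (Cmult_neq_0 w w Hw Hw).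
  replace (w * w) with (w * w * (w * / w)) by (field; assumption). rewrite H. ring.
Qed.

Lemma Cmod_Cexp (w : C) : Cmod (Cexp w) = exp (Re w).
Proof.
  unfold Cexp, Cmod; simpl fst; simpl snd.
  replace ((exp (Re w) * cos (Im w)) ^ 2 + (exp (Re w) * sin (Im w)) ^ 2)%R
    with (exp (Re w) * exp (Re w) * ((sin (Im w))² + (cos (Im w))²))%R
    by (unfold Rsqr; ring).
  rewrite sin2_cos2, Rmult_1_r. apply sqrt_square. left; apply exp_pos.
Qed.

Lemma Cmod_tpow (w k : C) : Cmod (tpow w k) = exp (Re k * Re w - Im k * Im w).
Proof. unfold tpow. rewrite Cmod_Cexp. f_equal. Qed.

Lemma tpow_neq_0 (w k : C) : tpow w k <> 0.
Proof. apply Cexp_neq_0. Qed.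

Lemma tpow_plus (w k l : C) : tpow w (k + l) = tpow w k * tpow w l.
Proof. unfold tpow. rewrite <- Cexp_plus. f_equal; ring. Qed.

Lemma tpow_minus (w k l : C) : tpow w (k - l) = tpow w k / tpow w l.
Proof.
  replace (tpow w k) with (tpow w (k - l) * tpow w l).
  - field. apply tpow_neq_0.
  - rewrite <- tpow_plus. f_equal; ring.
Qed.

Lemma tpow_1 (w : C) : tpow w 1 = Cexp w.
Proof. unfold tpow. f_equal; ring. Qed.

Lemma exp_le_exp (a b : R) : (a <= b)%R -> (exp a <= exp b)%R.
Proof. intros [H|H]; [left; now apply exp_increasing | rewrite H; lra]. Qed.

Lemma Rpower_exp (x k : R) : Rpower (exp x) k = exp (k * x).
Proof. unfold Rpower. now rewrite ln_exp. Qed.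

(** * Power bounds in sectors *)

Lemma sector_weaken (M M' K K' : R) (w : C) :
  (M <= M')%R -> (K <= K')%R -> sector M K w -> sector M' K' w.
Proof. intros HM HK [H1 H2]; split; lra. Qed.

Definition near_0 (P : C -> Prop) : Prop :=
  forall M : R, exists K : R, forall w : C, sector M K w -> P w.

Lemma near_0_and (P Q : C -> Prop) :
  near_0 P -> near_0 Q -> near_0 (fun w => P w /\ Q w).
Proof.
  intros HP HQ M. destruct (HP M) as [K HK], (HQ M) as [L HL].
  exists (Rmin K L). intros w Hw.
  split; [apply HK | apply HL]; (eapply sector_weaken; [| |exact Hw]);
    auto using Rle_refl, Rmin_l, Rmin_r.
Qed.

Lemma near_0_impl (P Q : C -> Prop) : (forall w, P w -> Q w) -> near_0 P -> near_0 Q.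
Proof. intros H HP M. destruct (HP M) as [K HK]. exists K. auto. Qed.

(** [f = O(|t|^k)] inside [E]; [K <= 0] and [0 < A] are normalizations. *)
Definition Opow (E : C -> Prop) (f : C -> C) (k : R) : Prop :=
  forall M : R, exists K A : R, (K <= 0 /\ 0 < A)%R /\ forall w : C,
    E w -> sector M K w -> (Cmod (f w) <= A * exp (k * Re w))%R.

(** Lowering the exponent is harmless because [K <= 0] forces [Re w < 0]; the inclusion of domains
    and the equality of functions only matter near [t = 0]. *)
Lemma Opow_mono (E E' : C -> Prop) (f g : C -> C) (k k' : R) :
  Opow E f k -> (k' <= k)%R -> near_0 (fun w => E' w -> E w /\ f w = g w) ->
  Opow E' g k'.
Proof.
  intros Hf Hk Hn M. destruct (Hf M) as [K [A [[HK HA] H]]], (Hn M) as [L HL].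
  exists (Rmin K L), A. pose proof (Rmin_l K L). split; [lra|]. intros w Ew Sw.
  destruct (HL w) as [Ew' <-]; [|exact Ew|].
  { eapply sector_weaken; [| |exact Sw]; auto using Rle_refl, Rmin_r. }
  eapply Rle_trans; [apply H; [exact Ew'|]|].
  - eapply sector_weaken; [| |exact Sw]; auto using Rle_refl, Rmin_l.
  - apply Rmult_le_compat_l; [lra|]. apply exp_le_exp. destruct Sw. nra.
Qed.

Lemma Opow_ext (E : C -> Prop) (f g : C -> C) (k : R) :
  (forall w, E w -> f w = g w) -> Opow E f k -> Opow E g k.
Proof.
  intros H Hf. apply (Opow_mono E E f g k k Hf (Rle_refl k)). intros M; exists 0%R; auto.
Qed.

Lemma Opow_weaken (E : C -> Prop) (f : C -> C) (k k' : R) :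
  Opow E f k -> (k' <= k)%R -> Opow E f k'.
Proof. intros Hf Hk. apply (Opow_mono E E f f k k' Hf Hk). intros M; exists 0%R; auto. Qed.

Lemma Opow_subset (E E' : C -> Prop) (f : C -> C) (k : R) :
  (forall w, E' w -> E w) -> Opow E f k -> Opow E' f k.
Proof. intros H Hf. apply (Opow_mono E E' f f k k Hf (Rle_refl k)). intros M; exists 0%R; auto. Qed.

Lemma Opow_plus (E : C -> Prop) (f g : C -> C) (k : R) :
  Opow E f k -> Opow E g k -> Opow E (fun w => f w + g w) k.
Proof.
  intros Hf Hg M. destruct (Hf M) as [K [A [[HK HA] H]]], (Hg M) as [L [B [[HL HB] H']]].
  exists (Rmin K L), (A + B)%R. pose proof (Rmin_l K L). split; [lra|]. intros w Ew Sw.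
  eapply Rle_trans; [apply Cmod_triangle|]. rewrite Rmult_plus_distr_r.
  apply Rplus_le_compat; [apply H | apply H']; try exact Ew;
    (eapply sector_weaken; [| |exact Sw]); auto using Rle_refl, Rmin_l, Rmin_r.
Qed.

Lemma Opow_opp (E : C -> Prop) (f : C -> C) (k : R) :
  Opow E f k -> Opow E (fun w => - f w) k.
Proof.
  intros Hf M. destruct (Hf M) as [K [A H]]. exists K, A.
  now setoid_rewrite Cmod_opp.
Qed.

Lemma Opow_minus (E : C -> Prop) (f g : C -> C) (k : R) :
  Opow E f k -> Opow E g k -> Opow E (fun w => f w - g w) k.
Proof. intros Hf Hg. apply Opow_plus; [|apply Opow_opp]; assumption. Qed.

Lemma Opow_mult (E : C -> Prop) (f g : C -> C) (k l m : R) :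
  Opow E f k -> Opow E g l -> (m <= k + l)%R -> Opow E (fun w => f w * g w) m.
Proof.
  intros Hf Hg Hm. apply Opow_weaken with (k + l)%R; [|assumption]. clear m Hm. intros M.
  destruct (Hf M) as [K [A [[HK HA] H]]], (Hg M) as [L [B [[HL HB] H']]].
  exists (Rmin K L), (A * B)%R. pose proof (Rmin_l K L).
  split; [split; [lra | now apply Rmult_lt_0_compat]|]. intros w Ew Sw.
  rewrite Cmod_mult, Rmult_plus_distr_r, exp_plus.
  replace (A * B * (exp (k * Re w) * exp (l * Re w)))%R
    with ((A * exp (k * Re w)) * (B * exp (l * Re w)))%R by ring.
  apply Rmult_le_compat; try apply Cmod_ge_0; [apply H | apply H']; try exact Ew;
    (eapply sector_weaken; [| |exact Sw]); auto using Rle_refl, Rmin_l, Rmin_r.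
Qed.

Lemma Opow_const (E : C -> Prop) (c : C) (k : R) : (k <= 0)%R -> Opow E (fun _ => c) k.
Proof.
  intros Hk. apply Opow_weaken with 0%R; [|assumption].
  intros M. exists 0%R, (Cmod c + 1)%R. pose proof (Cmod_ge_0 c). split; [lra|].
  intros. rewrite Rmult_0_l, exp_0. lra.
Qed.

(** The imaginary part of [s] only contributes the factor [exp (- Im s * Im w)], which is bounded in
    a sector. *)
Lemma Opow_tpow (E : C -> Prop) (s : C) (k : R) :
  (k <= Re s)%R -> Opow E (fun w => tpow w s) k.
Proof.
  intros Hk. apply Opow_weaken with (Re s); [|assumption].
  intros M. exists 0%R, (exp (Rabs (Im s) * M)). split; [split; [lra | apply exp_pos]|].
  intros w _ [Hw _]. rewrite Cmod_tpow, <- exp_plus. apply exp_le_exp.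
  assert (- (Im s * Im w) <= Rabs (Im s) * M)%R; [|lra].
  rewrite <- Rabs_Ropp in Hw. pose proof (Rle_abs (- (Im s * Im w))).
  pose proof (Rabs_pos (Im s)).
  rewrite Rabs_Ropp, Rabs_mult, <- (Rabs_Ropp (Im w)) in H. nra.
Qed.

Lemma Opow_Cexp (E : C -> Prop) (k : R) : (k <= 1)%R -> Opow E Cexp k.
Proof.
  intros Hk. eapply Opow_ext; [|apply (Opow_tpow E 1 k)]; [|exact Hk].
  intros; apply tpow_1.
Qed.

Lemma Opow_inv_tpow (E : C -> Prop) (s : C) (k : R) :
  (k <= - Re s)%R -> Opow E (fun w => / tpow w s) k.
Proof.
  intros Hk. eapply Opow_ext; [|apply (Opow_tpow E (- s) k Hk)].
  intros w _. replace (- s) with (0 - s) by ring. rewrite tpow_minus.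
  unfold tpow at 1. rewrite Cmult_0_l, Cexp_0. field. apply tpow_neq_0.
Qed.

Lemma Opow_small (E : C -> Prop) (f : C -> C) (k : R) :
  Opow E f k -> (0 < k)%R -> forall e : R, (0 < e)%R ->
  near_0 (fun w => E w -> (Cmod (f w) < e)%R).
Proof.
  intros Hf Hk e He M. destruct (Hf M) as [K [A [[HK HA] H]]].
  exists (Rmin K (ln (e / A) / k)). intros w Sw Ew.
  pose proof (Rmin_l K (ln (e / A) / k)). pose proof (Rmin_r K (ln (e / A) / k)).
  destruct Sw as [S1 S2].
  eapply Rle_lt_trans; [apply H; [exact Ew | split; lra]|].
  assert (He' : (0 < e / A)%R) by (apply Rdiv_lt_0_compat; assumption).
  apply Rlt_le_trans with (A * exp (ln (e / A)))%R.
  - apply Rmult_lt_compat_l; [assumption|]. apply exp_increasing.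
    assert (Hx : (Re w < ln (e / A) / k)%R) by lra.
    apply Rlt_div_r in Hx; lra.
  - rewrite exp_ln by assumption. right. field. lra.
Qed.

(** [|g|] is bounded below by some [/ B], and [f - g] tends to zero, so [|f|] is eventually at least
    half of that bound. *)
Lemma Opow_inv (E : C -> Prop) (f g : C -> C) (k : R) :
  Opow E (fun w => f w - g w) k -> (0 < k)%R -> (forall w, E w -> g w <> 0) ->
  Opow E (fun w => / g w) 0 ->
  near_0 (fun w => E w -> f w <> 0) /\ Opow E (fun w => / f w) 0.
Proof.
  intros Hfg Hk Hg0 Hg.
  assert (Key : forall M, exists K B, (K <= 0 /\ 0 < B)%R /\ forall w, E w -> sector M K w ->
    (/ (2 * B) <= Cmod (f w))%R).
  { intros M. destruct (Hg M) as [L [B [[HL HB] H']]].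
    assert (HB' : (0 < / (2 * B))%R) by (apply Rinv_0_lt_compat; lra).
    destruct (Opow_small E _ k Hfg Hk _ HB' M) as [K H].
    exists (Rmin K L), B. pose proof (Rmin_l K L). pose proof (Rmin_r K L).
    split; [lra|]. intros w Ew [S1 S2].
    specialize (H w ltac:(split; lra) Ew). specialize (H' w Ew ltac:(split; lra)).
    rewrite Rmult_0_l, exp_0, Rmult_1_r, Cmod_inv in H' by auto.
    assert (Hgw := proj1 (Cmod_gt_0 (g w)) (Hg0 w Ew)).
    assert (Hlow : (/ B <= Cmod (g w))%R).
    { rewrite <- (Rinv_inv (Cmod (g w))). apply Rinv_le_contravar; [|exact H'].
      now apply Rinv_0_lt_compat. }
    assert (Htri : (Cmod (g w) <= Cmod (f w) + Cmod (f w - g w))%R).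
    { replace (g w) with (f w + - (f w - g w)) at 1 by ring.
      eapply Rle_trans; [apply Cmod_triangle|]. rewrite Cmod_opp. lra. }
    replace (/ B)%R with (2 * / (2 * B))%R in Hlow by (field; lra). lra. }
  split.
  - intros M. destruct (Key M) as [K [B [[HK HB] H]]]. exists K. intros w Sw Ew E0.
    specialize (H w Ew Sw). rewrite E0, Cmod_0 in H.
    assert (0 < / (2 * B))%R by (apply Rinv_0_lt_compat; lra). lra.
  - intros M. destruct (Key M) as [K [B [[HK HB] H]]]. exists K, (2 * B)%R.
    split; [lra|]. intros w Ew Sw. specialize (H w Ew Sw).
    assert (0 < / (2 * B))%R by (apply Rinv_0_lt_compat; lra).
    rewrite Rmult_0_l, exp_0, Rmult_1_r, Cmod_inv by (apply Cmod_gt_0; lra).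
    rewrite <- (Rinv_inv (2 * B)). now apply Rinv_le_contravar.
Qed.

Lemma bigO_0_Opow (E : C -> Prop) (f : C -> C) (g : R -> R) (c k : R) :
  (forall x, (x <= 0)%R -> (0 <= g (exp x) <= c * exp (k * x))%R) ->
  bigO_0 E f g -> Opow E f k.
Proof.
  intros Hg H M. destruct (H M) as [K [A HK]].
  (* The constants of [bigO_0] may have any sign; the absolute values, the minimum and the added 1
     restore the normalization of [Opow]. *)
  exists (Rmin K 0), (Rabs A * Rabs c + 1)%R.
  pose proof (Rmin_l K 0). pose proof (Rmin_r K 0).
  pose proof (Rabs_pos A). pose proof (Rabs_pos c). split; [split; nra|].
  intros w Ew [S1 S2]. eapply Rle_trans; [apply HK; [exact Ew | split; lra]|].
  destruct (Hg (Re w) ltac:(lra)) as [G1 G2].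
  pose proof (Rle_abs A). pose proof (Rle_abs c). pose proof (exp_pos (k * Re w)).
  apply Rle_trans with (Rabs A * (Rabs c * exp (k * Re w)))%R; [|nra].
  apply Rle_trans with (Rabs A * g (exp (Re w)))%R; [nra|].
  apply Rmult_le_compat_l; nra.
Qed.

Lemma bigO_0_Opow_sum (E : C -> Prop) (f : C -> C) (k1 k2 k : R) :
  (k <= k1)%R -> (k <= k2)%R ->
  bigO_0 E f (fun x => Rpower x k1 + Rpower x k2)%R -> Opow E f k.
Proof.
  intros H1 H2. apply bigO_0_Opow with 2%R. intros x Hx. rewrite !Rpower_exp.
  pose proof (exp_pos (k1 * x)). pose proof (exp_pos (k2 * x)).
  assert (exp (k1 * x) <= exp (k * x))%R by (apply exp_le_exp; nra).
  assert (exp (k2 * x) <= exp (k * x))%R by (apply exp_le_exp; nra).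
  lra.
Qed.

Lemma Opow_bigO_0 (E : C -> Prop) (f : C -> C) (k : R) :
  Opow E f k -> bigO_0 E f (fun x => Rpower x k).
Proof.
  intros H M. destruct (H M) as [K [A [_ HK]]]. exists K, A.
  intros w Ew Sw. rewrite Rpower_exp. now apply HK.
Qed.

(** * Limits of functions with small derivative *)

Lemma Re_Im_le (w : C) : (Cmod w <= Rabs (Re w) + Rabs (Im w))%R.
Proof.
  destruct w as [a b]; simpl.
  replace (a, b) with (RtoC a + b * Ci) by (unfold Cplus, Cmult, RtoC, Ci; simpl; f_equal; ring).
  eapply Rle_trans; [apply Cmod_triangle|].
  rewrite Cmod_mult, !Cmod_R, Cmod_Ci. lra.
Qed.

Lemma Rabs_Re_le (w : C) : (Rabs (Re w) <= Cmod w)%R.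
Proof. eapply Rle_trans; [apply Rmax_l | apply Rmax_Cmod]. Qed.

Lemma Rabs_Im_le (w : C) : (Rabs (Im w) <= Cmod w)%R.
Proof. eapply Rle_trans; [apply Rmax_r | apply Rmax_Cmod]. Qed.

Lemma cofinite_dense (D : C -> Prop) (M : R) :
  cofinite_near_0 D -> exists K : R, forall w : C, sector M K w ->
  forall d : R, (0 < d)%R -> exists q : C, D q /\ (Cmod (q - w) < d)%R.
Proof.
  intros HD. destruct (HD M) as [K HK]. exists K. intros w Hw d Hd.
  destruct (locally'_C _ _ (HK w Hw)) as [e He]. pose proof (cond_pos e).
  set (h := (Rmin e d / 2)%R).
  assert (0 < Rmin e d)%R by (apply Rmin_pos; assumption).
  pose proof (Rmin_l e d); pose proof (Rmin_r e d).
  assert (Hh : Cmod (w + h - w) = h).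
  { replace (w + h - w) with (RtoC h) by ring. rewrite Cmod_R. apply Rabs_pos_eq.
    unfold h; lra. }
  exists (w + h). rewrite Hh. split; [|unfold h; lra].
  apply He; [rewrite Hh; unfold h; lra|].
  intros E. rewrite E in Hh. replace (w - w) with (RtoC 0) in Hh by ring.
  rewrite Cmod_0 in Hh. unfold h in Hh. lra.
Qed.

Lemma cofinite_point (D : C -> Prop) (b : R) :
  cofinite_near_0 D -> exists K : R, forall x : R, (x < K)%R ->
  exists q : C, D q /\ (Rabs (Re q - x) < 1)%R /\ (Rabs (Im q - b) < 1)%R.
Proof.
  intros HD. destruct (cofinite_dense D (Rabs b) HD) as [K HK].
  exists K. intros x Hx.
  destruct (HK (x, b) ltac:(split; simpl; lra) 1%R Rlt_0_1) as [q [Dq Hq]].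
  exists q. split; [exact Dq|].
  split; (eapply Rle_lt_trans; [|exact Hq]).
  - apply (Rabs_Re_le (q - (x, b))).
  - apply (Rabs_Im_le (q - (x, b))).
Qed.

(** The imaginary parts differ by at most [2 M], so a gap of at least [2 M + 1] between the real
    parts makes [Cmod (q - p)] at most twice that gap. The mean value estimate with
    [A / k * exp (k * x)] then gives the constant [2 A / k]. *)
Lemma far_left_estimate (D : C -> Prop) (f f' : C -> C) (k : R) :
  (0 < k)%R -> cofinite_near_0 D -> derivable_on D f f' -> Opow D f' k ->
  forall M : R, exists K A : R, (K <= 0 /\ 0 < A)%R /\
  forall p q : C, D p -> D q -> sector M K p -> sector M K q ->
  (2 * M + 1 <= Re p - Re q)%R -> (Cmod (f q - f p) <= A * exp (k * Re p))%R.
Proof.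
  intros Hk HD Hf Hf' M.
  destruct (Hf' (M + 1)%R) as [K1 [A [[HK1 HA] H1]]], (HD (M + 1)%R) as [K2 H2].
  exists (Rmin K1 K2), (2 * A / k)%R.
  pose proof (Rmin_l K1 K2). pose proof (Rmin_r K1 K2).
  split; [split; [lra | apply Rdiv_lt_0_compat; lra]|].
  intros p q Dp Dq Sp Sq HX.
  assert (HM : (0 <= M)%R) by (destruct Sp as [S _]; pose proof (Rabs_pos (Im p)); lra).
  assert (Hmv : (Cmod (f q - f p)%C * (Re p - Re q) <=
    Cmod (q - p)%C * (A / k * exp (k * Re p) - A / k * exp (k * Re q)))%R).
  { apply (derivable_on_mean_value D f f' (fun x => A / k * exp (k * x))%R
      (fun x => A * exp (k * x))%R M (Rmin K1 K2)); try assumption.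
    - intros w Sw. apply H2. eapply sector_weaken; [| |exact Sw]; lra.
    - intros w Dw Sw. apply H1; [exact Dw|]. eapply sector_weaken; [| |exact Sw]; lra.
    - intros x. auto_derive; [exact I | field; lra].
    - lra. }
  assert (Hdist : (Cmod (q - p) <= 2 * (Re p - Re q))%R).
  { eapply Rle_trans; [apply Re_Im_le|].
    destruct Sp as [Sp _], Sq as [Sq _].
    apply Rabs_le_between in Sp, Sq.
    replace (Re (q - p)) with (Re q - Re p)%R by (unfold Re; simpl; ring).
    replace (Im (q - p)) with (Im q - Im p)%R by (unfold Im; simpl; ring).
    rewrite Rabs_left by lra.
    assert (Rabs (Im q - Im p) <= 2 * M)%R by (apply Rabs_le; lra). lra. }
  pose proof (exp_pos (k * Re p)). pose proof (exp_pos (k * Re q)).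
  assert (HAk : (0 < A / k)%R) by (apply Rdiv_lt_0_compat; lra).
  pose proof (Cmod_ge_0 (q - p)). pose proof (Cmod_ge_0 (f q - f p)).
  apply Rmult_le_reg_r with (Re p - Re q)%R; [lra|].
  eapply Rle_trans; [exact Hmv|].
  apply Rle_trans with (2 * (Re p - Re q) * (A / k * exp (k * Re p)))%R.
  - assert (exp (k * Re q) <= exp (k * Re p))%R by (apply exp_le_exp; nra).
    apply Rmult_le_compat; [assumption | nra | assumption | nra].
  - right. field. lra.
Qed.

(** All points far to the left are compared with one fixed base point of [D]. *)
Lemma Opow_0_of_derivative (D : C -> Prop) (f f' : C -> C) (k : R) :
  (0 < k)%R -> cofinite_near_0 D -> derivable_on D f f' -> Opow D f' k -> Opow D f 0.
Proof.
  intros Hk HD Hf Hf' M.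
  (* The base point satisfies [|Im p| < 1], so the sector has to be at least that wide. *)
  destruct (far_left_estimate D f f' k Hk HD Hf Hf' (Rmax M 1)) as [K [A [[HK HA] H]]].
  destruct (cofinite_point D 0 HD) as [K' HK'].
  set (x := (Rmin K K' - 2)%R). pose proof (Rmin_l K K'). pose proof (Rmin_r K K').
  destruct (HK' x ltac:(unfold x; lra)) as [p [Dp [Hp1 Hp2]]].
  rewrite Rminus_0_r in Hp2. apply Rabs_def2 in Hp1.
  pose proof (Rmax_l M 1). pose proof (Rmax_r M 1).
  exists (Re p - (2 * Rmax M 1 + 1))%R, (Cmod (f p) + A)%R.
  pose proof (Cmod_ge_0 (f p)).
  assert (Re p < K)%R by (unfold x in Hp1; lra).
  split; [lra|]. intros w Dw [Sw1 Sw2].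
  specialize (H p w Dp Dw ltac:(split; lra) ltac:(split; lra) ltac:(lra)).
  rewrite Rmult_0_l, exp_0, Rmult_1_r.
  assert (exp (k * Re p) <= 1)%R by (rewrite <- exp_0; apply exp_le_exp; nra).
  replace (f w) with (f p + (f w - f p)) by ring.
  eapply Rle_trans; [apply Cmod_triangle|]. nra.
Qed.

(** Zero is only asked to be a cluster value at [t = 0] in one sector. For a function whose
    derivative decays like a positive power, and which therefore converges, this identifies the
    limit. *)
Definition small_values_near_0 (D : C -> Prop) (f : C -> C) : Prop :=
  exists M : R, forall e K : R, (0 < e)%R ->
    exists q : C, D q /\ sector M K q /\ (Cmod (f q) < e)%R.

(** Moving [q] towards [t = 0] through points with small [f q] turns the bound on [f q - f p] into
    one on [f p] alone. *)
Lemma Opow_of_derivative (D : C -> Prop) (f f' : C -> C) (k : R) :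
  (0 < k)%R -> cofinite_near_0 D -> derivable_on D f f' -> Opow D f' k ->
  small_values_near_0 D f -> Opow D f k.
Proof.
  intros Hk HD Hf Hf' [M0 Hacc] M.
  destruct (far_left_estimate D f f' k Hk HD Hf Hf' (Rmax M M0)) as [K [A [HKA H]]].
  exists K, A. split; [exact HKA|]. intros p Dp [Sp1 Sp2].
  pose proof (Rmax_l M M0). pose proof (Rmax_r M M0).
  apply le_epsilon. intros e He.
  destruct (Hacc e (Rmin K (Re p - (2 * Rmax M M0 + 1)))%R He) as [q [Dq [[Sq1 Sq2] Hq]]].
  pose proof (Rmin_l K (Re p - (2 * Rmax M M0 + 1))).
  pose proof (Rmin_r K (Re p - (2 * Rmax M M0 + 1))).
  specialize (H p q Dp Dq ltac:(split; lra) ltac:(split; lra) ltac:(lra)).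
  replace (f p) with (f q + - (f q - f p)) by ring.
  eapply Rle_trans; [apply Cmod_triangle|]. rewrite Cmod_opp. lra.
Qed.

Lemma small_values_Opow (D E : C -> Prop) (f : C -> C) (k : R) :
  (exists M : R, forall K : R, exists q : C, E q /\ sector M K q) ->
  (forall w, E w -> D w) -> Opow E f k -> (0 < k)%R -> small_values_near_0 D f.
Proof.
  intros [M HE] HED Hf Hk. exists M. intros e K He.
  destruct (Opow_small E f k Hf Hk e He M) as [L HL].
  destruct (HE (Rmin K L)) as [q [Eq Sq]]. exists q. repeat split.
  - auto.
  - apply Sq.
  - destruct Sq. pose proof (Rmin_l K L). lra.
  - apply HL; [|exact Eq].
    eapply sector_weaken; [| |exact Sq]; auto using Rle_refl, Rmin_r.
Qed.

(* [f] tends to a limit [l] and [S' -> alpha * l], so [l <> 0] would make [S]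
   grow linearly in [log t]. *)
Lemma small_values_of_bounded (D : C -> Prop) (f f' S S' : C -> C) (alpha : C) (k m : R) :
  (0 < k)%R -> (0 < m)%R -> alpha <> 0 -> cofinite_near_0 D ->
  derivable_on D f f' -> Opow D f' k ->
  derivable_on D S S' -> Opow D S 0 -> Opow D (fun w => S' w - alpha * f w) m ->
  small_values_near_0 D f.
Proof.
  intros Hk Hm Ha HD Hf Hf' HS HSb HS'. exists 1%R. intros e K He.
  assert (Ha' := proj1 (Cmod_gt_0 alpha) Ha).
  (* The argument ends with [|alpha| |f p| <= 3 e'], which is less than [|alpha| e]. *)
  set (e' := (Cmod alpha * e / 5)%R).
  assert (He' : (0 < e')%R).
  { unfold e'. apply Rdiv_lt_0_compat; [|lra]. now apply Rmult_lt_0_compat. }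
  destruct (far_left_estimate D f f' k Hk HD Hf Hf' 2) as [K1 [A [[HK1 HA] H1]]].
  destruct (Opow_small D _ m HS' Hm e' He' 2%R) as [K2 H2].
  destruct (HSb 2%R) as [K3 [B [[HK3 HB] H3]]].
  destruct (HD 2%R) as [K4 H4].
  destruct (cofinite_point D 0 HD) as [K5 H5].
  assert (HeA : (0 < e' / (A * Cmod alpha))%R)
    by (apply Rdiv_lt_0_compat; [assumption | now apply Rmult_lt_0_compat]).
  set (K6 := (ln (e' / (A * Cmod alpha)) / k)%R).
  set (L := (Rmin K (Rmin K1 (Rmin K2 (Rmin K3 (Rmin K4 (Rmin K5 K6))))))%R).
  assert (HL : (L <= K /\ L <= K1 /\ L <= K2 /\ L <= K3 /\ L <= K4 /\ L <= K5 /\ L <= K6)%R).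
  { unfold L.
    repeat split; repeat (first [apply Rle_refl | apply Rmin_l
      | eapply Rle_trans; [apply Rmin_r|]]). }
  clearbody L. destruct HL as [L0 [L1 [L2 [L3 [L4 [L5 L6]]]]]].
  destruct (H5 (L - 2)%R ltac:(lra)) as [p [Dp [Hp1 Hp2]]].
  (* By this choice [e' (N - 2) = 2 B]: over a distance of [N - 2] the bound on the variation of [S]
     costs at most [e'] per unit length. *)
  set (N := (2 * B / e' + 2)%R).
  assert (HN : (2 <= N)%R).
  { assert (0 < 2 * B / e')%R by (apply Rdiv_lt_0_compat; lra). unfold N; lra. }
  (* The points are only located up to 1. The offset 7 places [p1] to the left of [Re p - 5], and 5
     is the gap [2 * 2 + 1] required by [far_left_estimate] for [M = 2]. *)
  destruct (H5 (Re p - 7)%R) as [p1 [Dp1 [Hr1 Hi1]]]; [apply Rabs_def2 in Hp1; lra|].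
  destruct (H5 (Re p - 7 - N)%R) as [q [Dq [Hr2 Hi2]]]; [apply Rabs_def2 in Hp1; lra|].
  rewrite Rminus_0_r in Hp2, Hi1, Hi2. apply Rabs_def2 in Hp1, Hr1, Hr2.
  exists p. split; [exact Dp|]. split; [split; lra|].
  assert (Hexp : (A * exp (k * Re p) * Cmod alpha <= e')%R).
  { assert (Hx : (k * Re p <= ln (e' / (A * Cmod alpha)))%R).
    { assert (Hp6 : (Re p <= K6)%R) by lra. unfold K6 in Hp6.
      apply Rle_div_r in Hp6; lra. }
    apply exp_le_exp in Hx. rewrite exp_ln in Hx by assumption.
    apply Rle_div_r in Hx; [|now apply Rmult_lt_0_compat]. lra. }
  (* [g] is [S] without its expected linear growth; its derivative is at most [2 e'] to the left of
     [Re p - 5]. *)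
  set (g := fun w => S w - alpha * f p * w).
  assert (Hg : derivable_on D g (fun w => S' w - alpha * f p)).
  { eapply derivable_on_ext; [| |apply derivable_on_minus; [exact HS|];
      apply derivable_on_mult; [apply (derivable_on_const D (alpha * f p)) | apply derivable_on_id]].
    - reflexivity.
    - intros; cbv beta; ring. }
  assert (Hgb : (Cmod (g q - g p1)%C * (Re p1 - Re q) <=
    Cmod (q - p1)%C * (2 * e' * Re p1 - 2 * e' * Re q))%R).
  { apply (derivable_on_mean_value D g _ (fun x => 2 * e' * x)%R (fun _ => 2 * e')%R
      1 (Re p - 5)%R p1 q Hg); try assumption.
    - intros w Sw. apply H4. eapply sector_weaken; [| |exact Sw]; lra.
    - intros w Dw Sw.
      assert (Sw' : sector 2 L w) by (eapply sector_weaken; [| |exact Sw]; lra).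
      assert (Ew : (Cmod (f w - f p) <= A * exp (k * Re p))%R).
      { apply H1; try assumption.
        - split; lra.
        - eapply sector_weaken; [| |exact Sw']; lra.
        - destruct Sw; lra. }
      replace (S' w - alpha * f p) with (S' w - alpha * f w + alpha * (f w - f p)) by ring.
      eapply Rle_trans; [apply Cmod_triangle|].
      assert (E2 : (Cmod (S' w - alpha * f w) < e')%R).
      { apply H2; [|exact Dw]. eapply sector_weaken; [| |exact Sw']; lra. }
      rewrite Cmod_mult. nra.
    - intros x. auto_derive; [exact I | ring].
    - split; lra.
    - split; lra.
    - lra. }
  assert (HX : (0 < Re p1 - Re q)%R) by lra.
  assert (Hgb' : (Cmod (g q - g p1) <= 2 * e' * Cmod (q - p1))%R).
  { apply Rmult_le_reg_r with (Re p1 - Re q)%R; [exact HX|]. lra. }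
  assert (Hd : (N - 2 <= Cmod (q - p1))%R).
  { eapply Rle_trans; [|apply Rabs_Re_le].
    replace (Re (q - p1)) with (- (Re p1 - Re q))%R by (unfold Re; simpl; ring).
    rewrite Rabs_Ropp, Rabs_pos_eq; lra. }
  assert (HSq : (Cmod (S q) <= B)%R).
  { specialize (H3 q Dq ltac:(split; lra)). rewrite Rmult_0_l, exp_0 in H3. lra. }
  assert (HSp : (Cmod (S p1) <= B)%R).
  { specialize (H3 p1 Dp1 ltac:(split; lra)). rewrite Rmult_0_l, exp_0 in H3. lra. }
  assert (Hmain : (Cmod alpha * Cmod (f p) * Cmod (q - p1) <= 2 * B + 2 * e' * Cmod (q - p1))%R).
  { rewrite <- !Cmod_mult.
    replace (alpha * f p * (q - p1)) with (S q + - S p1 + - (g q - g p1)) by (unfold g; ring).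
    eapply Rle_trans; [apply Cmod_triangle|]. rewrite Cmod_opp.
    apply Rplus_le_compat; [|exact Hgb'].
    eapply Rle_trans; [apply Cmod_triangle|]. rewrite Cmod_opp. lra. }
  assert (HB' : (2 * B <= e' * Cmod (q - p1))%R).
  { replace (2 * B)%R with (e' * (N - 2))%R by (unfold N; field; lra). nra. }
  assert (Hd0 : (0 < Cmod (q - p1))%R).
  { apply Rlt_le_trans with (N - 2)%R; [|exact Hd]. unfold N.
    assert (0 < 2 * B / e')%R by (apply Rdiv_lt_0_compat; lra). lra. }
  assert (Hfin : (Cmod alpha * Cmod (f p) <= 3 * e')%R).
  { apply Rmult_le_reg_r with (Cmod (q - p1)); [exact Hd0|]. lra. }
  apply Rmult_lt_reg_l with (Cmod alpha); [exact Ha'|].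
  unfold e' in Hfin. assert (0 < Cmod alpha * e)%R by nra. lra.
Qed.

Lemma Opow_sqrt (E : C -> Prop) (f : C -> C) :
  Opow E (fun w => f w * f w) 0 -> Opow E f 0.
Proof.
  intros Hf M. destruct (Hf M) as [K [A [[HK HA] H]]]. exists K, (A + 1)%R.
  split; [lra|]. intros w Ew Sw. specialize (H w Ew Sw).
  rewrite Rmult_0_l, exp_0, Rmult_1_r in *. rewrite Cmod_mult in H.
  pose proof (Cmod_ge_0 (f w)). nra.
Qed.

(** * The zeta function of a solution *)

Section Zeta.

Variables Th0 Th1 Thoo sigma s2 : C.
Hypothesis sigma_neq_0 : sigma <> 0.
Hypothesis s2_neq_0 : s2 <> 0.
Hypothesis Re_sigma : (0 <= Re sigma < 1)%R.

Definition zeta_lim : C :=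
  / 4 * (sigma * sigma - Th1 * Th1 + Th0 * Th0 + 2 * Th0 * Thoo).

Definition zeta_cst : C := / 4 * ((Th0 + Thoo) * (Th0 + Thoo) - Th1 * Th1).

Definition e1 : C := (Th0 - Th1 + Thoo) / 2.
Definition e2 : C := (Th0 + Th1 + Thoo) / 2.

Local Notation b := (b_ Th0 Th1).
Local Notation c := (c_ Th0 Th1).
Local Notation d := (d_ Thoo).
Local Notation yn := (y_num Th0 Th1 Thoo sigma s2).
Local Notation yd := (y_den Th0 Th1 Thoo sigma s2).
Local Notation ym := (y_main Th0 Th1 Thoo sigma s2).
Local Notation zm := (z_main Th0 Th1 Thoo sigma s2).
Local Notation z2 := (z_second Th0 Th1 sigma s2).
Local Notation zetam := (zeta_main Th0 Th1 Thoo sigma s2).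
Local Notation T := (fun w => tpow w sigma).
Local Notation rho := (Re sigma).

(** This is [z_main] without its correction of order [t^(1 - 2 sigma)]; [zeta_main] integrates
    [- z_lead t] exactly. *)
Definition z_lead (w : C) : C :=
  (c sigma + s2 * d sigma * c (- sigma) * tpow w sigma)
  * (b sigma + s2 * d (- sigma) * b (- sigma) * tpow w sigma)
  / (sigma * sigma * s2 * tpow w sigma).

Lemma one_plus_sigma_neq_0 : 1 + sigma <> 0.
Proof. intros H. apply (f_equal fst) in H. unfold Re in *. simpl in H. lra. Qed.

Lemma one_minus_sigma_neq_0 : 1 - sigma <> 0.
Proof. intros H. apply (f_equal fst) in H. unfold Re in *. simpl in H. lra. Qed.

(** This is the relation [zeta'(t) = - z] multiplied by [t]; the first two equations of the system
    make all other terms cancel. *)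
Lemma zeta_derivable (D : C -> Prop) (y z : C -> C) :
  (forall w, D w -> y w <> 0) ->
  derivable_on D y (fun w => y_rhs Th0 Th1 Thoo (Cexp w) (y w) (z w)) ->
  derivable_on D z (fun w => z_rhs Th0 Th1 Thoo (Cexp w) (y w) (z w)) ->
  derivable_on D (fun w => zeta Th0 Th1 Thoo (Cexp w) (y w) (z w))
    (fun w => - (z w * Cexp w)).
Proof.
  intros Hy0 Hy Hz.
  eapply derivable_on_ext; [| |
    exact (derivable_on_minus _ _ _ _ _
      (derivable_on_minus _ _ _ _ _ (derivable_on_const D zeta_cst)
        (derivable_on_mult _ _ _ _ _ Hz (derivable_on_Cexp D)))
      (derivable_on_mult _ _ _ _ _
        (derivable_on_minus _ _ _ _ _ Hz
          (derivable_on_mult _ _ _ _ _ (derivable_on_inv _ _ _ Hy0 Hy)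
            (derivable_on_plus _ _ _ _ _ Hz (derivable_on_const D e2))))
        (derivable_on_minus _ _ _ _ _
          (derivable_on_plus _ _ _ _ _ Hz (derivable_on_const D Th0))
          (derivable_on_mult _ _ _ _ _ Hy
            (derivable_on_plus _ _ _ _ _ Hz (derivable_on_const D e1))))))].
  - reflexivity.
  - intros w Dw. unfold y_rhs, z_rhs, e1, e2. field. now apply Hy0.
Qed.

(** The three nonconstant terms of [zeta_main] are the antiderivatives of the powers
    [t^(1 - sigma)], [t] and [t^(1 + sigma)] in [- z_lead t]. The divisions by [1 - sigma] and
    [1 + sigma] are legitimate since [0 <= Re sigma < 1]. *)
Lemma zeta_main_derivable (D : C -> Prop) :
  derivable_on D zetam
    (fun w => - ((zm w - 2 * (z2 w * z2 w) * Cexp w) * Cexp w)).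
Proof.
  pose proof one_plus_sigma_neq_0 as H1. pose proof one_minus_sigma_neq_0 as H2.
  eapply derivable_on_ext; [| |
    exact (derivable_on_minus _ _ _ _ _
      (derivable_on_plus _ _ _ _ _
        (derivable_on_minus _ _ _ _ _ (derivable_on_const D zeta_lim)
          (derivable_on_mult _ _ _ _ _
            (derivable_on_const D (((Th1 + sigma) * (Th1 + sigma) - Th0 * Th0)
              / (4 * s2 * (sigma * sigma) * (1 - sigma))))
            (derivable_on_tpow D (1 - sigma))))
        (derivable_on_mult _ _ _ _ _ (derivable_on_Cexp D)
          (derivable_on_const D (/ (4 * (sigma * sigma))
            * (2 * Th0 * (sigma * sigma)
              + Thoo * (Th0 * Th0 - Th1 * Th1 + sigma * sigma))))))
      (derivable_on_mult _ _ _ _ _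
        (derivable_on_const D (s2 * (Thoo * Thoo - sigma * sigma)
          * ((Th1 - sigma) * (Th1 - sigma) - Th0 * Th0)
          / (16 * (sigma * sigma) * (1 + sigma))))
        (derivable_on_tpow D (1 + sigma))))].
  - intros w. unfold zeta_main, zeta_lim, Cdiv. ring.
  - intros w _. unfold z_main, z_second.
    rewrite tpow_minus, tpow_plus, tpow_1.
    pose proof (tpow_neq_0 w sigma). generalize dependent (tpow w sigma). intros t Ht.
    unfold a_, b_, c_, d_. field. repeat split; assumption.
Qed.

Lemma zeta_main_limit (E : C -> Prop) :
  Opow E (fun w => zetam w - zeta_lim) (1 - rho).
Proof.
  set (c1 := ((Th1 + sigma) * (Th1 + sigma) - Th0 * Th0)
    / (4 * s2 * (sigma * sigma) * (1 - sigma))).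
  set (c2 := / (4 * (sigma * sigma)) * (2 * Th0 * (sigma * sigma)
    + Thoo * (Th0 * Th0 - Th1 * Th1 + sigma * sigma))).
  set (c3 := s2 * (Thoo * Thoo - sigma * sigma)
    * ((Th1 - sigma) * (Th1 - sigma) - Th0 * Th0) / (16 * (sigma * sigma) * (1 + sigma))).
  apply Opow_ext with
    (fun w => - (c1 * tpow w (1 - sigma)) + Cexp w * c2 - c3 * tpow w (1 + sigma)).
  { intros w _. unfold zeta_main, zeta_lim, c1, c2, c3, Cdiv. ring. }
  apply Opow_minus; [apply Opow_plus; [apply Opow_opp|]|].
  - apply Opow_mult with 0%R (1 - rho)%R; [apply Opow_const; lra | | lra].
    apply Opow_tpow. unfold Re; simpl; lra.
  - apply Opow_mult with 1%R 0%R; [apply Opow_Cexp; lra | apply Opow_const; lra | lra].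
  - apply Opow_mult with 0%R (1 + rho)%R; [apply Opow_const; lra | | lra].
    apply Opow_tpow. unfold Re; simpl; lra.
Qed.

Lemma Opow_z_second (E : C -> Prop) : Opow E z2 (- rho).
Proof.
  apply Opow_ext with
    (fun w => b sigma * c sigma / (sigma * sigma * (1 - sigma) * s2) * / tpow w sigma).
  { intros w _. unfold z_second. pose proof (tpow_neq_0 w sigma).
    pose proof one_minus_sigma_neq_0. field. tauto. }
  apply Opow_mult with 0%R (- rho)%R; [apply Opow_const; lra | apply Opow_inv_tpow; lra | lra].
Qed.

Lemma Opow_z_lead (E : C -> Prop) : Opow E z_lead (- rho).
Proof.
  apply Opow_ext with (fun w =>
    (c sigma + s2 * d sigma * c (- sigma) * tpow w sigma)
    * (b sigma + s2 * d (- sigma) * b (- sigma) * tpow w sigma)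
    * (/ (sigma * sigma * s2) * / tpow w sigma)).
  { intros w _. unfold z_lead. pose proof (tpow_neq_0 w sigma). field. tauto. }
  assert (Hlin : forall p q : C, Opow E (fun w => p + q * tpow w sigma) 0).
  { intros p q. apply Opow_plus; [apply Opow_const; lra|].
    apply Opow_mult with 0%R rho; [apply Opow_const; lra | apply Opow_tpow; lra | lra]. }
  apply Opow_mult with 0%R (- rho)%R; [|  |lra].
  - apply Opow_mult with 0%R 0%R; [apply Hlin | apply Hlin | lra].
  - apply Opow_mult with 0%R (- rho)%R; [apply Opow_const; lra | apply Opow_inv_tpow; lra | lra].
Qed.

(** * Error estimates along a solution *)

Section Solution.

Variables (D : C -> Prop) (y z : C -> C).
Hypothesis D_cofinite : cofinite_near_0 D.
Hypothesis y_neq_0 : forall w, D w -> y w <> 0.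
Hypothesis y_deriv : derivable_on D y (fun w => y_rhs Th0 Th1 Thoo (Cexp w) (y w) (z w)).
Hypothesis z_deriv : derivable_on D z (fun w => z_rhs Th0 Th1 Thoo (Cexp w) (y w) (z w)).
Hypothesis y_asym : forall delta : R, (0 < delta)%R ->
  bigO_0 (fun w => D w /\ away delta yd w) (fun w => y w - ym w)
    (fun x => Rpower x (1 + rho) + Rpower x (2 - rho))%R.
Hypothesis z_asym : bigO_0 D (fun w => z w - zm w)
  (fun x => Rpower x (1 - rho) + Rpower x (2 - 3 * rho))%R.

Local Notation zet := (fun w => zeta Th0 Th1 Thoo (Cexp w) (y w) (z w)).
Local Notation f := (fun w => zeta Th0 Th1 Thoo (Cexp w) (y w) (z w) - zetam w).
Local Notation f' := (fun w => - (z w * Cexp w)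
  - - ((zm w - 2 * (z2 w * z2 w) * Cexp w) * Cexp w)).

Lemma f_deriv : derivable_on D f f'.
Proof.
  apply derivable_on_minus; [now apply zeta_derivable | apply zeta_main_derivable].
Qed.

(** Here the final exponent arises: for [0 <= rho < 1] both error exponents of [z] are at least
    [1 - 2 rho], and multiplication by [t] adds 1; the term with [z2^2 t^2] has the same order. *)
Lemma Opow_f' : Opow D f' (2 - 2 * rho).
Proof.
  apply Opow_ext with
    (fun w => - ((z w - zm w) * Cexp w + 2 * ((z2 w * z2 w) * (Cexp w * Cexp w)))).
  { intros w _. ring. }
  apply Opow_opp, Opow_plus.
  - apply Opow_mult with (1 - 2 * rho)%R 1%R; [| apply Opow_Cexp; lra | lra].
    eapply bigO_0_Opow_sum; [| |exact z_asym]; lra.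
  - apply Opow_mult with 0%R (2 - 2 * rho)%R; [apply Opow_const; lra | | lra].
    apply Opow_mult with (- 2 * rho)%R 2%R; [| |lra].
    + apply Opow_mult with (- rho)%R (- rho)%R; [apply Opow_z_second .. | lra].
    + apply Opow_mult with 1%R 1%R; [apply Opow_Cexp .. |]; lra.
Qed.

Lemma Opow_z_minus_lead : Opow D (fun w => z w - z_lead w) (1 - 2 * rho).
Proof.
  apply Opow_ext with (fun w => (z w - zm w) + 2 * ((z2 w * z2 w) * Cexp w)).
  { intros w _. unfold z_main, z_lead. ring. }
  apply Opow_plus.
  - eapply bigO_0_Opow_sum; [| |exact z_asym]; lra.
  - apply Opow_mult with 0%R (1 - 2 * rho)%R; [apply Opow_const; lra | | lra].
    apply Opow_mult with (- 2 * rho)%R 1%R; [| apply Opow_Cexp; lra | lra].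
    apply Opow_mult with (- rho)%R (- rho)%R; [apply Opow_z_second .. | lra].
Qed.

Lemma Opow_z : Opow D z (- rho).
Proof.
  apply Opow_ext with (fun w => (z w - z_lead w) + z_lead w); [intros; ring|].
  apply Opow_plus; [|apply Opow_z_lead].
  apply Opow_weaken with (1 - 2 * rho)%R; [apply Opow_z_minus_lead | lra].
Qed.

Lemma Opow_zt : Opow D (fun w => z w * Cexp w) (1 - rho).
Proof. apply Opow_mult with (- rho)%R 1%R; [apply Opow_z | apply Opow_Cexp; lra | lra]. Qed.

Lemma Opow_f : small_values_near_0 D f -> Opow D f (2 - 2 * rho).
Proof.
  apply Opow_of_derivative with f'; [lra | assumption | apply f_deriv | apply Opow_f'].
Qed.

Lemma Opow_y (delta : R) : (0 < delta)%R ->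
  Opow (fun w => D w /\ away delta yd w) (fun w => y w - yn w / yd w) 1.
Proof.
  intros Hdelta.
  apply Opow_ext with (fun w => (y w - ym w)
    + (1 - Th1 - Th0) / ((1 - sigma) * (1 - sigma)) * Cexp w).
  { intros w _. unfold y_main. ring. }
  apply Opow_plus.
  - eapply bigO_0_Opow_sum; [| |exact (y_asym delta Hdelta)]; lra.
  - apply Opow_mult with 0%R 1%R; [apply Opow_const; lra | apply Opow_Cexp; lra | lra].
Qed.

(** [z_lead] grows like [|t|^(- rho)] and [1 - Y] is of order [|t|^rho], so [X0] is bounded and
    [X - X0] has order [1 - rho]. An exact identity between the leading terms then makes the
    constant terms of [zeta] and [zeta_main] agree. *)
Lemma Opow_f_direct (E : C -> Prop) (delta : R) :
  (0 < delta)%R ->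
  (forall w, E w -> D w /\ away delta yd w /\ yd w <> 0 /\ yn w <> 0) ->
  Opow E (fun w => 1 - yn w / yd w) rho ->
  Opow E (fun w => yd w / yn w) 0 ->
  Opow E f (1 - rho).
Proof.
  intros Hdelta HE HY1 HY2.
  assert (HED : forall w, E w -> D w) by (intros w Ew; apply (HE w Ew)).
  set (Y := fun w => yn w / yd w).
  set (X0 := fun w => z_lead w * (1 - Y w)).
  set (X := fun w => z w * (1 - y w)).
  assert (Hy : Opow E (fun w => y w - Y w) 1).
  { eapply Opow_subset; [|exact (Opow_y delta Hdelta)].
    intros w Ew. destruct (HE w Ew) as [H1 [H2 _]]. now split. }
  assert (HY0 : forall w, E w -> Y w <> 0).
  { intros w Ew. destruct (HE w Ew) as [_ [_ [H1 H2]]].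
    apply Cmult_neq_0; [assumption | now apply Cinv_neq_0]. }
  assert (HYb : Opow E Y 0).
  { apply Opow_ext with (fun w => 1 - (1 - Y w)); [intros; ring|].
    apply Opow_minus; [apply Opow_const; lra|].
    apply Opow_weaken with rho; [exact HY1 | lra]. }
  assert (Hyb : Opow E y 0).
  { apply Opow_ext with (fun w => (y w - Y w) + Y w); [intros; ring|].
    apply Opow_plus; [|exact HYb]. apply Opow_weaken with 1%R; [exact Hy | lra]. }
  assert (Hyi : Opow E (fun w => / y w) 0).
  { apply (Opow_inv E y Y 1 Hy ltac:(lra) HY0).
    eapply Opow_ext; [|exact HY2]. intros w Ew. destruct (HE w Ew) as [_ [_ [H1 H2]]].
    unfold Y. field. now split. }
  assert (Hz := Opow_subset D E z _ HED Opow_z).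
  assert (Hzl := Opow_subset D E _ _ HED Opow_z_minus_lead).
  assert (HX0 : Opow E X0 0).
  { apply Opow_mult with (- rho)%R rho; [apply Opow_z_lead | exact HY1 | lra]. }
  assert (HdX : Opow E (fun w => X w - X0 w) (1 - rho)).
  { apply Opow_ext with
      (fun w => (z w - z_lead w) * (1 - Y w) - z w * (y w - Y w)).
    { intros w _. unfold X, X0. ring. }
    apply Opow_minus.
    - apply Opow_mult with (1 - 2 * rho)%R rho; [exact Hzl | exact HY1 | lra].
    - apply Opow_mult with (- rho)%R 1%R; [exact Hz | exact Hy | lra]. }
  assert (HX : Opow E X 0).
  { apply Opow_ext with (fun w => (X w - X0 w) + X0 w); [intros; ring|].
    apply Opow_plus; [|exact HX0]. apply Opow_weaken with (1 - rho)%R; [exact HdX | lra]. }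
  assert (Hid : forall w, E w ->
    (X0 w + e2) * (X0 w + Th0 - e1 * Y w) = Y w * (zeta_lim - zeta_cst)).
  { intros w Ew. destruct (HE w Ew) as [_ [_ [H1 H2]]].
    unfold X0, Y, z_lead, zeta_lim, zeta_cst, e1, e2, y_num, y_den in *.
    pose proof (tpow_neq_0 w sigma). generalize dependent (tpow w sigma). intros t H1 H2 Ht.
    (* The side conditions of [field] are the two factors of [yd] up to powers of 2; the divisors 8
       and 32 restore the halves in [b_], [c_] and [d_]. *)
    unfold a_, b_, c_, d_ in *. field. repeat split; try assumption; intros E0; apply H1.
    - match goal with |- _ * ?v = _ => match type of E0 with ?l = _ =>
        replace v with (l / 8) by field end end. rewrite E0. field.
    - match goal with |- ?v * _ = _ => match type of E0 with ?l = _ =>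
        replace v with (l / 32) by field end end. rewrite E0. field. }
  assert (Hy' : Opow E (fun w => y w - Y w) (1 - rho))
    by (apply Opow_weaken with 1%R; [exact Hy | lra]).
  assert (Hc : forall u : C, Opow E (fun _ => u) 0) by (intros; apply Opow_const; lra).
  (* Subtracting [Hid] from the same expression in [X] and [y] leaves products that each contain one
     of the small differences [X - X0], [y - Y]. *)
  apply Opow_ext with (fun w =>
    / y w * ((X w - X0 w) * (X w + Th0 - e1 * y w)
      + (X0 w + e2) * ((X w - X0 w) - e1 * (y w - Y w))
      - (y w - Y w) * (zeta_lim - zeta_cst))
    - z w * Cexp w - (zetam w - zeta_lim)).
  { intros w Ew. specialize (Hid w Ew). specialize (y_neq_0 w (HED w Ew)).
    assert (HP : (X w - X0 w) * (X w + Th0 - e1 * y w)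
      + (X0 w + e2) * ((X w - X0 w) - e1 * (y w - Y w)) - (y w - Y w) * (zeta_lim - zeta_cst)
      = (X w + e2) * (X w + Th0 - e1 * y w) - y w * (zeta_lim - zeta_cst)
        - ((X0 w + e2) * (X0 w + Th0 - e1 * Y w) - Y w * (zeta_lim - zeta_cst))) by ring.
    rewrite HP, Hid. unfold zeta, zeta_cst, zeta_lim, X, e1, e2. field. assumption. }
  apply Opow_minus; [|apply zeta_main_limit].
  apply Opow_minus; [|exact (Opow_subset D E _ _ HED Opow_zt)].
  apply Opow_mult with 0%R (1 - rho)%R; [exact Hyi | | lra].
  apply Opow_minus; [apply Opow_plus|].
  - apply Opow_mult with (1 - rho)%R 0%R; [exact HdX | | lra].
    apply Opow_minus; [apply Opow_plus; [exact HX | apply Hc]|].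
    apply Opow_mult with 0%R 0%R; [apply Hc | exact Hyb | lra].
  - apply Opow_mult with 0%R (1 - rho)%R; [| | lra].
    + apply Opow_plus; [exact HX0 | apply Hc].
    + apply Opow_minus; [exact HdX|].
      apply Opow_mult with 0%R (1 - rho)%R; [apply Hc | exact Hy' | lra].
  - apply Opow_mult with (1 - rho)%R 0%R; [exact Hy' | apply Hc | lra].
Qed.

(** * Regions in which the leading quotient of [y] is controlled *)

Lemma Opow_linear (E : C -> Prop) (p q : C) : Opow E (fun w => p + q * tpow w sigma) 0.
Proof.
  apply Opow_plus; [apply Opow_const; lra|].
  apply Opow_mult with 0%R rho; [apply Opow_const; lra | apply Opow_tpow; lra | lra].
Qed.

Lemma Opow_linear_minus (E : C -> Prop) (p q : C) :
  Opow E (fun w => p + q * tpow w sigma - p) rho.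
Proof.
  apply Opow_ext with (fun w => q * tpow w sigma); [intros; ring|].
  apply Opow_mult with 0%R rho; [apply Opow_const; lra | apply Opow_tpow; lra | lra].
Qed.

Lemma Opow_y_num (E : C -> Prop) : Opow E yn 0.
Proof. apply Opow_mult with 0%R 0%R; [apply Opow_linear .. | lra]. Qed.

Lemma Opow_y_den (E : C -> Prop) : Opow E yd 0.
Proof. apply Opow_mult with 0%R 0%R; [apply Opow_linear .. | lra]. Qed.

Lemma Opow_product_minus (E : C -> Prop) (p q p' q' : C) :
  Opow E (fun w => (p + q * tpow w sigma) * (p' + q' * tpow w sigma) - p * p') rho.
Proof.
  apply Opow_ext with (fun w => (p + q * tpow w sigma - p) * (p' + q' * tpow w sigma)
    + p * (p' + q' * tpow w sigma - p')); [intros; ring|].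
  apply Opow_plus.
  - apply Opow_mult with rho 0%R; [apply Opow_linear_minus | apply Opow_linear | lra].
  - apply Opow_mult with 0%R rho; [apply Opow_const; lra | apply Opow_linear_minus | lra].
Qed.

(** [E] need only contain, near [t = 0], a strip around the line [Im w = b0]: such a strip contains
    points of [D] arbitrarily far to the left, and there [Opow_f_direct] applies. *)
Lemma small_values_of_leading (b0 : R) (E : C -> Prop) :
  (forall w, E w -> yd w <> 0 /\ yn w <> 0 /\ away 1 yd w) ->
  (forall M, exists K, forall w, sector M K w -> (Rabs (Im w - b0) < 1)%R -> E w) ->
  Opow E (fun w => 1 - yn w / yd w) rho ->
  Opow E (fun w => yd w / yn w) 0 ->
  small_values_near_0 D f.
Proof.
  intros HE HP H1 H2.
  assert (HED : forall w, D w /\ E w -> D w) by tauto.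
  assert (HEE : forall w, D w /\ E w -> E w) by tauto.
  apply (small_values_Opow D (fun w => D w /\ E w) f (1 - rho)); [| exact HED | | lra].
  - exists (Rabs b0 + 1)%R. intros K.
    destruct (HP (Rabs b0 + 1)%R) as [K1 HK1], (cofinite_point D b0 D_cofinite) as [K2 HK2].
    set (x := (Rmin K (Rmin K1 K2) - 2)%R).
    pose proof (Rmin_l K (Rmin K1 K2)). pose proof (Rmin_r K (Rmin K1 K2)).
    pose proof (Rmin_l K1 K2). pose proof (Rmin_r K1 K2).
    destruct (HK2 x ltac:(unfold x; lra)) as [q [Dq [Hq1 Hq2]]].
    apply Rabs_def2 in Hq1.
    assert (Hq3 : (Rabs (Im q) <= Rabs b0 + 1)%R).
    { replace (Im q) with (b0 + (Im q - b0))%R by ring.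
      eapply Rle_trans; [apply Rabs_triang|]. lra. }
    exists q. split; [split; [exact Dq|]|].
    + apply HK1; [|exact Hq2]. split; [exact Hq3 | unfold x in *; lra].
    + split; [exact Hq3 | unfold x in *; lra].
  - apply (Opow_f_direct _ 1 Rlt_0_1).
    + intros w [Dw Ew]. destruct (HE w Ew) as [? [? ?]]. tauto.
    + exact (Opow_subset _ _ _ _ HEE H1).
    + exact (Opow_subset _ _ _ _ HEE H2).
Qed.

(** A zero at distance less than 1 would lie in a sector enlarged by 1, where [g] has no zeros. *)
Lemma near_0_away (g : C -> C) :
  near_0 (fun w => g w <> 0) -> near_0 (fun w => away 1 g w).
Proof.
  intros Hg M. destruct (Hg (M + 1)%R) as [K HK]. exists (K - 1)%R.
  intros w [Hw1 Hw2] p Hp. apply Rnot_lt_le; intros Hlt.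
  apply (HK p); [|exact Hp].
  pose proof (Rabs_Re_le (w - p)) as HR. pose proof (Rabs_Im_le (w - p)) as HI.
  assert (HR' : (Rabs (Re w - Re p) < 1)%R) by (eapply Rle_lt_trans; [exact HR | exact Hlt]).
  assert (HI' : (Rabs (Im w - Im p) < 1)%R) by (eapply Rle_lt_trans; [exact HI | exact Hlt]).
  apply Rabs_def2 in HR', HI'. apply Rabs_le_between in Hw1.
  split; [apply Rabs_le|]; lra.
Qed.

Lemma y_den_unfold (w : C) : yd w =
  (b sigma * c sigma + (s2 * d sigma * (b (- sigma) * c (- sigma))) * tpow w sigma)
  * (b sigma + (s2 * d (- sigma) * b (- sigma)) * tpow w sigma).
Proof. reflexivity. Qed.

Lemma y_num_unfold (w : C) : yn w =
  (b sigma * c sigma + (s2 * d (- sigma) * (b (- sigma) * c (- sigma))) * tpow w sigma)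
  * (b sigma + (s2 * d sigma * b (- sigma)) * tpow w sigma).
Proof. reflexivity. Qed.

Hypothesis y_den_neq_0 : exists w, yd w <> 0.

(** Now [t^sigma] tends to zero, so [yn] and [yd] are governed by their lowest powers of [t^sigma],
    and these agree. *)
Lemma small_values_generic : (0 < rho)%R -> c sigma <> 0 -> small_values_near_0 D f.
Proof.
  intros Hrho Hc.
  assert (Key : near_0 (fun w => yd w <> 0) /\ near_0 (fun w => yn w <> 0) /\
    Opow (fun w => yd w <> 0) (fun w => 1 - yn w / yd w) rho /\
    Opow (fun w => yn w <> 0) (fun w => yd w / yn w) 0).
  { destruct (classic (b sigma = 0)) as [Hb|Hb].
    (* For [b sigma = 0] numerator and denominator are the same monomial in [t^sigma]; being nonzero
       at one point, it vanishes nowhere. *)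
    - assert (Heq : forall w, yn w = yd w).
      { intros w. rewrite y_den_unfold, y_num_unfold, Hb. ring. }
      assert (Hd : forall w, yd w <> 0).
      { intros w E. destruct y_den_neq_0 as [w0 H0]. apply H0.
        pose proof (tpow_neq_0 w sigma).
        replace (yd w0) with (yd w * (tpow w0 sigma * tpow w0 sigma)
          / (tpow w sigma * tpow w sigma)).
        - rewrite E. field. assumption.
        - rewrite !y_den_unfold, Hb. field. assumption. }
      repeat split; try (intros M; exists 0%R; intros w _; rewrite ?Heq; apply Hd).
      + apply Opow_ext with (fun _ => 0 * tpow 0 0).
        { intros w _. rewrite Heq. field. apply Hd. }
        intros M. exists 0%R, 1%R. split; [lra|]. intros.
        rewrite Cmult_0_l, Cmod_0. pose proof (exp_pos (rho * Re w)). lra.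
      + apply Opow_ext with (fun _ => 1); [|apply Opow_const; lra].
        intros w _. rewrite Heq. field. apply Hd.
    (* [A] is the common nonzero limit of [yn] and [yd]. *)
    - set (A := b sigma * c sigma * b sigma).
      assert (HA : A <> 0) by (apply Cmult_neq_0; [now apply Cmult_neq_0 | assumption]).
      assert (Hd : forall E : C -> Prop, Opow E (fun w => yd w - A) rho)
        by (intros; apply Opow_product_minus).
      assert (Hn : forall E : C -> Prop, Opow E (fun w => yn w - A) rho)
        by (intros; apply Opow_product_minus).
      assert (Hi : forall E : C -> Prop, Opow E (fun _ => / A) 0)
        by (intros; apply Opow_const; lra).
      assert (Hd' := fun E => Opow_inv E yd (fun _ => A) rho (Hd E) Hrho (fun _ _ => HA) (Hi E)).
      assert (Hn' := fun E => Opow_inv E yn (fun _ => A) rho (Hn E) Hrho (fun _ _ => HA) (Hi E)).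
      repeat split.
      + eapply near_0_impl; [|apply (Hd' (fun _ => True))]. auto.
      + eapply near_0_impl; [|apply (Hn' (fun _ => True))]. auto.
      + apply Opow_ext with (fun w => ((yd w - A) - (yn w - A)) * / yd w).
        { intros w Hw. field. exact Hw. }
        apply Opow_mult with rho 0%R; [apply Opow_minus; auto | apply Hd' | lra].
      + apply Opow_mult with 0%R 0%R; [apply Opow_y_den | apply Hn' | lra]. }
  destruct Key as [Hd [Hn [H1 H2]]].
  apply (small_values_of_leading 0 (fun w => yd w <> 0 /\ yn w <> 0 /\ away 1 yd w)).
  - tauto.
  - intros M. destruct (near_0_and _ _ Hd (near_0_and _ _ Hn (near_0_away _ Hd)) M) as [K HK].
    exists K. intros w Sw _. now apply HK.
  - eapply Opow_subset; [|exact H1]. tauto.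
  - eapply Opow_subset; [|exact H2]. tauto.
Qed.

(** If [q <> 0] the reverse triangle inequality applies for large [t]; otherwise the expression is a
    nonzero constant. *)
Lemma linear_lower_bound (p q : C) : (exists t, p + q * t <> 0) ->
  exists L m : R, (0 < m)%R /\ forall t, (L <= Cmod t)%R -> (m <= Cmod (p + q * t))%R.
Proof.
  intros [t0 H0]. destruct (classic (q = 0)) as [Hq|Hq].
  - exists 0%R, (Cmod p). subst q. split.
    + apply Cmod_gt_0. intros E. apply H0. rewrite E. ring.
    + intros t _. replace (p + 0 * t) with p by ring. lra.
  - assert (Hq' := proj1 (Cmod_gt_0 q) Hq).
    exists ((Cmod p + 1) / Cmod q)%R, 1%R. split; [lra|]. intros t Ht.
    apply Rle_div_l in Ht; [|exact Hq'].
    assert (Htri : (Cmod (q * t) <= Cmod (p + q * t) + Cmod p)%R).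
    { replace (q * t) with (p + q * t + - p) at 1 by ring.
      eapply Rle_trans; [apply Cmod_triangle|]. rewrite Cmod_opp. lra. }
    rewrite Cmod_mult in Htri. lra.
Qed.

(* For purely imaginary [sigma] the modulus of [t^sigma] depends on [arg t]
   only: it is constant along the horizontal lines, and large on a suitable one. *)
Lemma small_values_imaginary : rho = 0%R ->
  (exists t, b sigma * c sigma + (s2 * d (- sigma) * (b (- sigma) * c (- sigma))) * t <> 0) ->
  (exists t, b sigma + (s2 * d sigma * b (- sigma)) * t <> 0) ->
  small_values_near_0 D f.
Proof.
  intros Hrho N1 N2.
  assert (F12 : (exists t, b sigma * c sigma
      + (s2 * d sigma * (b (- sigma) * c (- sigma))) * t <> 0) /\
    (exists t, b sigma + (s2 * d (- sigma) * b (- sigma)) * t <> 0)).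
  { destruct y_den_neq_0 as [w Hw]. rewrite y_den_unfold in Hw.
    split; exists (tpow w sigma); intros E; apply Hw; rewrite E; ring. }
  destruct F12 as [F1 F2].
  destruct (linear_lower_bound _ _ N1) as [R1 [m1 [Hm1 H1]]],
    (linear_lower_bound _ _ N2) as [R2 [m2 [Hm2 H2]]],
    (linear_lower_bound _ _ F1) as [R3 [m3 [Hm3 H3]]],
    (linear_lower_bound _ _ F2) as [R4 [m4 [Hm4 H4]]].
  set (R0 := (Rmax 1 (Rmax (Rmax R1 R2) (Rmax R3 R4)))%R).
  assert (HR0 : (1 <= R0 /\ R1 <= R0 /\ R2 <= R0 /\ R3 <= R0 /\ R4 <= R0)%R).
  { unfold R0.
    repeat split; try apply Rmax_l; (eapply Rle_trans; [|apply Rmax_r]).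
    - eapply Rle_trans; [|apply Rmax_l]; apply Rmax_l.
    - eapply Rle_trans; [|apply Rmax_l]; apply Rmax_r.
    - eapply Rle_trans; [|apply Rmax_r]; apply Rmax_l.
    - eapply Rle_trans; [|apply Rmax_r]; apply Rmax_r. }
  clearbody R0. destruct HR0 as [HR0 [HR1 [HR2 [HR3 HR4]]]].
  assert (Hnu : Im sigma <> 0%R).
  { intros E. apply sigma_neq_0. destruct sigma as [u v]. simpl in *. subst. reflexivity. }
  set (nu := Im sigma) in *.
  (* On the line [Im w = b0] the modulus of [t^sigma] is [R0 * exp (2 * Rabs nu)], hence still at
     least [R0] within distance 2. This 2 covers the half-width 1 of [E] and the radius 1 in
     [away]. *)
  set (b0 := (- (ln R0 + 2 * Rabs nu) / nu)%R).
  assert (HT : forall w, (Rabs (Im w - b0) < 2)%R -> (R0 <= Cmod (tpow w sigma))%R).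
  { intros w Hw. rewrite Cmod_tpow. fold nu. rewrite Hrho.
    rewrite <- (exp_ln R0) at 1 by lra. apply exp_le_exp.
    replace (0 * Re w - nu * Im w)%R with (ln R0 + 2 * Rabs nu - nu * (Im w - b0))%R
      by (unfold b0; field; assumption).
    pose proof (Rle_abs (nu * (Im w - b0))) as Hle. rewrite Rabs_mult in Hle.
    pose proof (Rabs_pos nu). nra. }
  assert (Hdn : forall w, (Rabs (Im w - b0) < 2)%R ->
    (m3 * m4 <= Cmod (yd w))%R /\ (m1 * m2 <= Cmod (yn w))%R).
  { intros w Hw. specialize (HT w Hw).
    rewrite y_den_unfold, y_num_unfold, !Cmod_mult.
    specialize (H1 (tpow w sigma) ltac:(lra)). specialize (H2 (tpow w sigma) ltac:(lra)).
    specialize (H3 (tpow w sigma) ltac:(lra)). specialize (H4 (tpow w sigma) ltac:(lra)).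
    split; apply Rmult_le_compat; lra. }
  assert (Hm34 : (0 < m3 * m4)%R) by now apply Rmult_lt_0_compat.
  assert (Hm12 : (0 < m1 * m2)%R) by now apply Rmult_lt_0_compat.
  assert (Hnz : forall w, (Rabs (Im w - b0) < 2)%R -> yd w <> 0 /\ yn w <> 0).
  { intros w Hw. destruct (Hdn w Hw). split; apply Cmod_gt_0; lra. }
  set (E := fun w => (Rabs (Im w - b0) < 1)%R).
  assert (Hinv : forall (g : C -> C) (m : R), (0 < m)%R ->
    (forall w, E w -> (m <= Cmod (g w))%R) -> Opow E (fun w => / g w) 0).
  { intros g m Hm Hg M. exists 0%R, (/ m)%R.
    split; [split; [lra | now apply Rinv_0_lt_compat]|]. intros w Ew _.
    specialize (Hg w Ew).
    rewrite Rmult_0_l, exp_0, Rmult_1_r, Cmod_inv by (apply Cmod_gt_0; lra).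
    now apply Rinv_le_contravar. }
  apply (small_values_of_leading b0 E).
  - intros w Ew. unfold E in Ew. destruct (Hnz w ltac:(lra)) as [Hd Hn].
    repeat split; try assumption. intros p Hp. apply Rnot_lt_le; intros Hlt.
    refine (proj1 (Hnz p _) Hp).
    replace (Im p - b0)%R with (- (Im w - Im p) + (Im w - b0))%R by ring.
    eapply Rle_lt_trans; [apply Rabs_triang|]. rewrite Rabs_Ropp.
    pose proof (Rabs_Im_le (w - p)) as HI.
    assert (HI' : (Rabs (Im w - Im p) < 1)%R) by (eapply Rle_lt_trans; [exact HI | exact Hlt]).
    lra.
  - intros M. exists 0%R. intros w _ Hw. exact Hw.
  - rewrite Hrho. apply Opow_minus; [apply Opow_const; lra|].
    apply Opow_mult with 0%R 0%R; [apply Opow_y_num | | lra].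
    apply (Hinv yd (m3 * m4)%R Hm34). intros w Ew. unfold E in Ew. apply Hdn. lra.
  - apply Opow_mult with 0%R 0%R; [apply Opow_y_den | | lra].
    apply (Hinv yn (m1 * m2)%R Hm12). intros w Ew. unfold E in Ew. apply Hdn. lra.
Qed.

(* Here [z] may fail to be determined by its expansion up to [o(1)] (for
   [Re sigma >= 2/3]), and [y] may tend to [0]. *)
Lemma small_values_degenerate : c sigma = 0 -> b sigma <> 0 ->
  (0 < rho)%R \/ d (- sigma) = 0 -> small_values_near_0 D f.
Proof.
  intros Hc Hb Hcase.
  assert (HTh1 : Th1 = Th0 - sigma).
  { replace Th1 with (2 * c sigma + Th0 - sigma) by (unfold c_; field). rewrite Hc. ring. }
  assert (Hda : s2 * d sigma * (b (- sigma) * c (- sigma)) <> 0).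
  { intros E. destruct y_den_neq_0 as [w Hw]. apply Hw.
    rewrite y_den_unfold, E, Hc. ring. }
  assert (Hd : d sigma <> 0) by (intros E; apply Hda; rewrite E; ring).
  (* [g] is the second factor of [yd]. It tends to [b sigma] if [rho > 0] and is constant if
     [d (- sigma) = 0]; in the constant case [k = 1] is chosen, matching the error of [y]. *)
  set (g := fun w => b sigma + s2 * d (- sigma) * b (- sigma) * tpow w sigma).
  assert (Hg : exists k, (0 < k <= 1)%R /\
    forall E : C -> Prop, Opow E (fun w => g w - b sigma) k).
  { destruct Hcase as [Hrho|Hd'].
    - exists rho. split; [lra|]. intros. apply Opow_linear_minus.
    - exists 1%R. split; [lra|]. intros E.
      apply Opow_ext with (fun w => 0 * Cexp w).
      + intros w _. unfold g. rewrite Hd'. ring.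
      + apply Opow_mult with 0%R 1%R; [apply Opow_const | apply Opow_Cexp |]; lra. }
  destruct Hg as [k [Hk Hg]].
  assert (Hginv := fun E => Opow_inv E g (fun _ => b sigma) k (Hg E) (proj1 Hk) (fun _ _ => Hb)
    (Opow_const E (/ b sigma) 0 (Rle_refl 0))).
  assert (Hydg : forall w, yd w =
    s2 * d sigma * (b (- sigma) * c (- sigma)) * tpow w sigma * g w).
  { intros w. rewrite y_den_unfold, Hc. unfold g. ring. }
  assert (Hgn : near_0 (fun w => g w <> 0)).
  { eapply near_0_impl; [|apply (Hginv (fun _ => True))]. auto. }
  assert (Hyd : near_0 (fun w => yd w <> 0)).
  { eapply near_0_impl; [|exact Hgn]. intros w Hw. simpl in Hw. rewrite Hydg.
    apply Cmult_neq_0; [apply Cmult_neq_0; [exact Hda | apply tpow_neq_0] | exact Hw]. }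
  (* [Ys] is the limit of [y]: since [c sigma = 0], the first factors of [yn] and [yd] are both
     multiples of [t^sigma], with ratio [Ys]. *)
  set (Ys := d (- sigma) / d sigma).
  assert (HY : Opow D (fun w => y w - Ys) k).
  { apply (Opow_mono (fun w => (D w /\ away 1 yd w) /\ yd w <> 0) D
      (fun w => (y w - yn w / yd w) + sigma / d sigma * ((g w - b sigma) * / g w)) _ k k);
      [|lra|].
    - apply Opow_plus.
      + apply Opow_weaken with 1%R; [|lra].
        eapply Opow_subset; [|exact (Opow_y 1 Rlt_0_1)]. tauto.
      + apply Opow_mult with 0%R k; [apply Opow_const; lra | | lra].
        apply Opow_mult with k 0%R; [apply Hg | apply Hginv | lra].
    - eapply near_0_impl; [|exact (near_0_and _ _ Hgn (near_0_and _ _ Hyd (near_0_away _ Hyd)))].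
      intros w [Hgw [Hyw Haw]] Dw. repeat split; try assumption.
      assert (Hyn : yn w = s2 * d (- sigma) * (b (- sigma) * c (- sigma)) * tpow w sigma
        * (g w + sigma * s2 * b (- sigma) * tpow w sigma)).
      { rewrite y_num_unfold, Hc. unfold g, d_. field. }
      assert (Hgb : g w - b sigma = s2 * d (- sigma) * b (- sigma) * tpow w sigma)
        by (unfold g; ring).
      rewrite Hyn, Hydg, Hgb. unfold Ys. clearbody g. field.
      repeat split; try assumption; try apply tpow_neq_0.
      all: intros E; apply Hda; rewrite E; ring. }
  assert (H1Ys : 1 - Ys = sigma / d sigma).
  { unfold Ys. replace (d (- sigma)) with (d sigma - sigma) by (unfold d_; field).
    field. exact Hd. }
  (* This is the bracket in [S'] below evaluated at the limits of [zeta_main] and [y]. Its vanishing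
     is what makes [S'] tend to a multiple of [f] with no constant left over. *)
  assert (Hlim : - 2 * (zeta_lim - zeta_cst) + e1 * (Th0 - e2 - e1 * Ys) = 0).
  { assert (Hd2 : Thoo + sigma <> 0).
    { intros E. apply Hd. unfold d_. rewrite E. field. }
    unfold zeta_lim, zeta_cst, e1, e2, Ys, d_. rewrite HTh1. field. exact Hd2. }
  set (Z := fun w => zeta Th0 Th1 Thoo (Cexp w) (y w) (z w) - zeta_cst + z w * Cexp w).
  set (S := fun w => 2 * (z w * (1 - y w)) + e2 + Th0 - e1 * y w).
  set (S' := fun w => (1 - y w) * (- 2 * Z w + e1 * (Th0 - e2 - e1 * y w))
    - (2 * z w + e1) * (Cexp w * y w)).
  assert (HS : derivable_on D S S').
  { eapply derivable_on_ext; [| |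
      exact (derivable_on_minus _ _ _ _ _
        (derivable_on_plus _ _ _ _ _
          (derivable_on_plus _ _ _ _ _
            (derivable_on_mult _ _ _ _ _ (derivable_on_const D 2)
              (derivable_on_mult _ _ _ _ _ z_deriv
                (derivable_on_minus _ _ _ _ _ (derivable_on_const D 1) y_deriv)))
            (derivable_on_const D e2))
          (derivable_on_const D Th0))
        (derivable_on_mult _ _ _ _ _ (derivable_on_const D e1) y_deriv))].
    - reflexivity.
    - intros w Dw. unfold S', Z, zeta, zeta_cst, y_rhs, z_rhs, e1, e2. field. auto. }
  (* [y Z] is the product of [X + e2] and [X + Th0 - e1 y], where [X = z (1 - y)]; [S] is their sum
     and [e2 - Th0 + e1 y] their difference. *)
  assert (Hsq : forall w, D w ->
    4 * (y w * Z w) + (e2 - Th0 + e1 * y w) * (e2 - Th0 + e1 * y w) = S w * S w).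
  { intros w Dw. unfold S, Z, zeta, zeta_cst, e1, e2. field. auto. }
  assert (Hyb : Opow D y 0).
  { apply Opow_ext with (fun w => (y w - Ys) + Ys); [intros; ring|].
    apply Opow_plus; [|apply Opow_const; lra]. apply Opow_weaken with k; [exact HY | lra]. }
  assert (Hzt0 : Opow D (fun w => z w * Cexp w) 0)
    by (apply Opow_weaken with (1 - rho)%R; [apply Opow_zt | lra]).
  (* Boundedness of [f] follows from its derivative alone, before the limit is known; it bounds [Z]
     and then [S]. *)
  assert (Hf0 : Opow D f 0).
  { apply (Opow_0_of_derivative D f f' (2 - 2 * rho));
      [lra | assumption | apply f_deriv | apply Opow_f']. }
  assert (HZb : Opow D Z 0).
  { apply Opow_ext with (fun w => (zeta Th0 Th1 Thoo (Cexp w) (y w) (z w) - zetam w)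
      + (zetam w - zeta_lim) + (zeta_lim - zeta_cst) + z w * Cexp w);
      [intros; unfold Z; ring|].
    apply Opow_plus; [|exact Hzt0]. apply Opow_plus; [|apply Opow_const; lra].
    apply Opow_plus; [exact Hf0|].
    apply Opow_weaken with (1 - rho)%R; [apply zeta_main_limit | lra]. }
  assert (Hc0 : forall u : C, Opow D (fun _ => u) 0) by (intros; apply Opow_const; lra).
  assert (Hlin : forall u v : C, Opow D (fun w => u + v * y w) 0).
  { intros u v. apply Opow_plus; [apply Hc0|].
    apply Opow_mult with 0%R 0%R; [apply Hc0 | exact Hyb | lra]. }
  assert (HSb : Opow D S 0).
  { apply Opow_sqrt. eapply Opow_ext; [exact Hsq|]. apply Opow_plus.
    - apply Opow_mult with 0%R 0%R; [apply Hc0 | | lra].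
      apply Opow_mult with 0%R 0%R; [exact Hyb | exact HZb | lra].
    - apply Opow_mult with 0%R 0%R; [apply Hlin | apply Hlin | lra]. }
  set (m := Rmin k (1 - rho)).
  assert (Hmk : (m <= k)%R) by apply Rmin_l.
  assert (Hmr : (m <= 1 - rho)%R) by apply Rmin_r.
  assert (Hm0 : (0 < m)%R) by (apply Rmin_pos; lra).
  apply (small_values_of_bounded D f f' S S' (- 2 * (1 - Ys)) (2 - 2 * rho) m);
    try assumption.
  - lra.
  - rewrite H1Ys. apply Cmult_neq_0.
    + intros E. apply (f_equal fst) in E. simpl in E. lra.
    + apply Cmult_neq_0; [assumption | now apply Cinv_neq_0].
  - apply f_deriv.
  - apply Opow_f'.
  - apply Opow_ext with (fun w =>
      (1 - Ys) * (- 2 * (zetam w - zeta_lim) - 2 * (z w * Cexp w) - e1 * e1 * (y w - Ys))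
      - (y w - Ys) * (- 2 * Z w + e1 * ((Th0 - e2) + - e1 * y w))
      - (2 * (z w * Cexp w) + e1 * Cexp w) * y w).
    { intros w _. unfold S'.
      transitivity ((1 - Ys) * (- 2 * (zetam w - zeta_lim) - 2 * (z w * Cexp w) - e1 * e1 * (y w - Ys)
        + (- 2 * (zeta_lim - zeta_cst) + e1 * (Th0 - e2 - e1 * Ys)))
      - (y w - Ys) * (- 2 * Z w + e1 * ((Th0 - e2) + - e1 * y w))
      - (2 * (z w * Cexp w) + e1 * Cexp w) * y w).
      - rewrite Hlim. ring.
      - unfold Z. ring. }
    assert (Hzt : Opow D (fun w => z w * Cexp w) m)
      by (apply Opow_weaken with (1 - rho)%R; [apply Opow_zt | exact Hmr]).
    assert (HY' : Opow D (fun w => y w - Ys) m)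
      by (apply Opow_weaken with k; [exact HY | exact Hmk]).
    assert (Hsc : forall (u : C) (h : C -> C), Opow D h m -> Opow D (fun w => u * h w) m).
    { intros u h Hh. apply Opow_mult with 0%R m; [apply Hc0 | exact Hh | lra]. }
    apply Opow_minus; [apply Opow_minus|].
    + apply Hsc. apply Opow_minus; [apply Opow_minus|]; apply Hsc; try assumption.
      apply Opow_weaken with (1 - rho)%R; [apply zeta_main_limit | exact Hmr].
    + apply Opow_mult with m 0%R; [exact HY' | | lra]. apply Opow_plus.
      * apply Opow_mult with 0%R 0%R; [apply Hc0 | exact HZb | lra].
      * apply Opow_mult with 0%R 0%R; [apply Hc0 | apply Hlin | lra].
    + apply Opow_mult with m 0%R; [| exact Hyb | lra].
      apply Opow_plus; apply Hsc; [exact Hzt | apply Opow_Cexp; lra].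
Qed.

(** Since [Th0 = b sigma - c sigma] is nonzero, [b sigma] and [c sigma] do not both vanish, so
    [c sigma = 0] leads to the degenerate case. *)
Lemma small_values_all : not_integer Th0 -> small_values_near_0 D f.
Proof.
  intros HTh0.
  assert (Hbc : c sigma = 0 -> b sigma <> 0).
  { intros Hc Hb. apply (HTh0 0%Z).
    replace Th0 with (b sigma - c sigma) by (unfold b_, c_; field).
    rewrite Hb, Hc. ring. }
  destruct (Rlt_or_le 0 rho) as [Hrho|Hrho].
  - destruct (classic (c sigma = 0)) as [Hc|Hc].
    + apply small_values_degenerate; auto.
    + now apply small_values_generic.
  - assert (Hrho0 : rho = 0%R) by lra.
    destruct y_den_neq_0 as [w Hw]. rewrite y_den_unfold in Hw.
    destruct (classic (exists t, b sigma + (s2 * d sigma * b (- sigma)) * t <> 0)) as [N2|N2].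
    + destruct (classic (exists t, b sigma * c sigma
        + (s2 * d (- sigma) * (b (- sigma) * c (- sigma))) * t <> 0)) as [N1|N1].
      * now apply small_values_imaginary.
      (* If the first factor of [yn] is identically zero while [yd] is not, then [d (- sigma) = 0],
         [b sigma <> 0] and [c sigma = 0]: the second alternative of the degenerate case. *)
      * assert (N1' : forall t, b sigma * c sigma
          + (s2 * d (- sigma) * (b (- sigma) * c (- sigma))) * t = 0)
          by (intros t; apply NNPP; intros E; apply N1; now exists t).
        assert (Ha : b sigma * c sigma = 0) by (rewrite <- (N1' 0); ring).
        assert (Hda : d (- sigma) = 0).
        { apply NNPP; intros Hd.
          assert (H1 : s2 * d (- sigma) * (b (- sigma) * c (- sigma)) = 0)
            by (rewrite <- (N1' 1), Ha; ring).
          assert (H2 : b (- sigma) * c (- sigma) = 0).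
          { apply NNPP; intros H2. revert H1. apply Cmult_neq_0; [now apply Cmult_neq_0 | exact H2]. }
          apply Hw. rewrite H2, Ha. ring. }
        assert (Hb : b sigma <> 0) by (intros E; apply Hw; rewrite Hda, E; ring).
        apply small_values_degenerate; [|exact Hb | now right].
        apply NNPP; intros Hc. revert Ha. now apply Cmult_neq_0.
    (* If the second factor of [yn] vanished identically, then [b sigma = 0] and
       [d sigma * b (- sigma) = 0], and the first factor of [yd] would vanish too. *)
    + exfalso.
      assert (N2' : forall t, b sigma + (s2 * d sigma * b (- sigma)) * t = 0)
        by (intros t; apply NNPP; intros E; apply N2; now exists t).
      apply Hw.
      replace (b sigma * c sigma + s2 * d sigma * (b (- sigma) * c (- sigma)) * tpow w sigma)
        with (b sigma * c sigma + c (- sigma)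
          * (b sigma + s2 * d sigma * b (- sigma) * tpow w sigma - b sigma)) by ring.
      assert (Hb : b sigma = 0) by (rewrite <- (N2' 0); ring).
      rewrite N2', Hb. ring.
Qed.

End Solution.

End Zeta.

Theorem corollary7p1 :
  forall Th0 Th1 Thoo sigma s2 r : C,
    not_integer Th0 -> not_integer Th1 ->
    sigma <> 0 -> s2 <> 0 -> r <> 0 ->
    (0 <= Re sigma < 1)%R ->
  forall (D : C -> Prop) (y z u : C -> C),
    ids_solution Th0 Th1 Thoo D y z u ->
    small_t_asymptotics Th0 Th1 Thoo sigma s2 r D y z u ->
    bigO_0 D
      (fun tau =>
         zeta Th0 Th1 Thoo (Cexp tau) (y tau) (z tau)
         - zeta_main Th0 Th1 Thoo sigma s2 tau)
      (fun x => Rpower x (2 - 2 * Re sigma)).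
Proof.
  intros Th0 Th1 Thoo sigma s2 r HTh0 _ Hsigma Hs2 _ Hre D y z u
    [HD Hode] [Hyd [Hy [Hz _]]].
  assert (Hy0 : forall w, D w -> y w <> 0) by (intros w Dw; apply (Hode w Dw)).
  assert (Hdy : derivable_on D y (fun w => y_rhs Th0 Th1 Thoo (Cexp w) (y w) (z w)))
    by (apply derivable_on_is_derive; intros w Dw; apply (Hode w Dw)).
  assert (Hdz : derivable_on D z (fun w => z_rhs Th0 Th1 Thoo (Cexp w) (y w) (z w)))
    by (apply derivable_on_is_derive; intros w Dw; apply (Hode w Dw)).
  (* What remains after the derivative estimate is that zero is a cluster value of the
     difference. *)
  apply Opow_bigO_0, Opow_f; try assumption.
  eapply small_values_all; eassumption.
Qed.
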